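(* Let $m$ and $k$ be positive integers with $3\le k\le m-1$, and let $G=\mathrm{Sym}(m)$ be the symmetric group of degree $m$ in its action on the $k$-subsets of $\{1,\ldots,m\}$, with orbit dimension $\sigma(m,k)$. Let $$k'=\frac{4\big((k-1)^{2k}-1\big)}{k-2},$$ and let $q,r\in\mathbb{N}$ (nonnegative integers) be such that $m=k'q+r$ with $r<k'$. Then $$\frac{6m-8}{3k+1}\le \sigma(m,k)\le \frac{2k'q}{k}+\left(\left\lfloor\frac{k}{2}\right\rfloor+1\right)r\le \frac{2m}{k}+\left(\left\lfloor\frac{k}{2}\right\rfloor+1\right)(k'-1).$$
   Context: For a permutation group $G$ on a finite set $\Omega$, $\alpha\in\Omega$ separates $\omega,\omega'\in\Omega$ if $\omega,\omega'$ lie in distinct orbits of the stabilizer $G_\alpha$; $S\subseteq\Omega$ is separating for $G$ if any two distinct elements of $\Omega$ are separated by some $\alpha\in S$; the orbit dimension of $G$ is the minimum cardinality of a separating set. $\sigma(m,k)$ denotes the orbit dimension of $\mathrm{Sym}(m)$ acting on the $k$-subsets of $\{1,\ldots,m\}$. Equivalently, $\sigma(m,k)$ is the minimum size of a family $S$ of $k$-subsets of $\{1,\ldots,m\}$ such that for any two distinct $k$-subsets $\omega,\omega'$ there is $\alpha\in S$ with $|\omega\cap\alpha|\ne|\omega'\cap\alpha|$; this is also the metric dimension of the Johnson graph $J(m,k)$. *)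

(* Defs.v *)
From mathcomp Require Import all_boot all_order all_fingroup all_algebra.

Set Implicit Arguments.
Unset Strict Implicit.
Unset Printing Implicit Defensive.

Import Order.TTheory GRing.Theory Num.Theory.

Section OrbitDimension.
Import GroupScope.

Variables (aT : finGroupType) (T : finType) (to : {action aT &-> T}).

Definition separates (G : {group aT}) (a w w' : T) : bool :=
  w' \notin orbit to 'C_G[a | to] w.

(* In the intended uses G acts on Omega, i.e. [acts G, on Omega | to]; orbits
   of points of Omega are then the same whether taken in Omega or in T. *)
Definition separating (G : {group aT}) (Omega S : {set T}) : bool :=
  (S \subset Omega) &&
  [forall w in Omega, forall w' in Omega,
     (w != w') ==> [exists a in S, separates G a w w']].

(* The default value Omega of the minimum is itself separating. *)
Definition orbit_dim (G : {group aT}) (Omega : {set T}) : nat :=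
  #|[arg min_(S < Omega | separating G Omega S) #|S|]|.

Lemma separating_full (G : {group aT}) (Omega : {set T}) :
  separating G Omega Omega.
Proof.
rewrite /separating subxx /=.
apply/forall_inP => w Ow; apply/forall_inP => w' _; apply/implyP => nww'.
apply/exists_inP; exists w => //; apply/negP => /orbitP [g].
rewrite inE => /andP [_ /astab1P ->] eww'.
by rewrite eww' eqxx in nww'.
Qed.

Lemma orbit_dim_min (G : {group aT}) (Omega S : {set T}) :
  separating G Omega S -> orbit_dim G Omega <= #|S|.
Proof.
rewrite /orbit_dim; case: arg_minnP => [|? _]; [exact: separating_full | exact].
Qed.

Lemma orbit_dim_attained (G : {group aT}) (Omega : {set T}) :
  exists2 S, separating G Omega S & #|S| = orbit_dim G Omega.
Proof.
rewrite /orbit_dim; case: arg_minnP => [|S sS _]; first exact: separating_full.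
by exists S.
Qed.

End OrbitDimension.

Definition ksubsets (m k : nat) : {set {set 'I_m}} :=
  [set A : {set 'I_m} | #|A| == k].

(* 'P^* is the action of permutations on sets by taking images. *)
Definition sigma (m k : nat) : nat :=
  orbit_dim ('P^*)%act [set: 'S_m]%G (ksubsets m k).

Lemma Sym_acts_on_ksubsets (m k : nat) :
  [acts [set: 'S_m], on ksubsets m k | ('P^*)%act].
Proof.
apply/actsP => s _ A; rewrite !inE /= card_imset //.
exact: (@act_inj _ _ _ 'P%act).
Qed.

Local Open Scope ring_scope.

(* This is an integer for k >= 3, as k - 2 divides (k - 1)^(2k) - 1. *)
Definition kprime (k : nat) : rat :=
  4%:R * ((k%:R - 1) ^+ (2 * k) - 1) / (k%:R - 2%:R).

(* Main.v *)
Require Import Defs.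
From mathcomp Require Import all_boot all_order all_fingroup all_algebra.
From mathcomp Require Import zify ring.

Import Order.TTheory GRing.Theory Num.Theory.

(** A family of [k]-subsets separates the [k]-subsets if and only if two of them
    meeting every member equally often are equal, because the stabilizer of [a]
    is the setwise stabilizer of a subset ([separating_ksubsetsP]).

    Lower bound ([lower_bound]).  Call the column of a point the set of the
    members that contain it, and its size the degree of the point.  Two disjoint
    lists of at most three points with the same sum of columns could be completed
    to two [k]-subsets that are not separated.  So columns are distinct, there is
    at most one point of degree 0, and the points of degree 2, seen as edges on
    the family, avoid certain configurations around the members that have a
    point of degree 1.  This bounds three times the number of points of degree 1
    by the size [s] of the family, up to a constant and the incidences at points
    of degree at least 3; counting all the [k * s] incidences gives the bound.
    This needs [m >= k + 3]; for smaller [m] the distinctness of the columns is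
    enough.

    Upper bound.  Let the points be the edges of a [k]-regular bipartite graph
    with [N] vertices on each side and no cycle of length at most [2 * k], and
    take as sets the [2 * N] stars of its vertices.  The symmetric difference [D]
    of two [k]-subsets has at most [2 * k] edges, hence is a forest and has a
    leaf; the star of that leaf meets [D] in one edge, and so separates the two
    sets.  Points outside such a block cost one set each ([sigma_le_block]).
    Blocks can be added, so the theorem follows once a block exists with exactly
    [N = kprime k / k], that is [block_size k = 4 * \sum_(i < k) (k - 1) ^ (2 * i)]
    ([block_sizeP]).  When [m] is below [kprime k], the bound follows from
    [sigma m k <= m].

    Such blocks are cut out of one bipartite graph of large girth.  Its edges are
    truncated matrices of determinant 1 over [F[x]], for a finite field [F], and
    its vertices are the orbits of two groups of elementary matrices.  The degree
    of a reduced alternating word in these matrices grows with every letter, so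
    that no word of length at most [2 * k] is closed ([no_closed_word]).  The graph
    is [#|F|]-regular; restricting two coordinates of the edges to [k] values
    gives a [k]-regular piece with [k * L] vertices on a side, where [L] is a power
    of [#|F|] ([piece_fixed]).  With [k + 1] values one has to remove a perfect
    matching; some vertices can be removed with it, and then the number of
    vertices may be [(k + 1) * L - y] for every small [y] ([piece_flexible]) or for
    certain larger [y] ([piece_slices]).

    Since [k] and [k + 1] are coprime, sums of pieces over the field of [p]
    elements give all large [N] ([block_of_prime]); [block_size k] is large enough
    if [p] is not much larger than [k].  For [k >= 9] such a prime exists, by
    explicit primes first and by the prime factorisation of a central binomial
    coefficient beyond these ([prime_in_window]).  For [5 <= k <= 8] pieces are
    combined by hand, and for [k = 3] and [k = 4] the block consists of copies of
    a small graph on which an affine group acts ([block_bicayley]). *)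

Set Implicit Arguments.
Unset Strict Implicit.
Unset Printing Implicit Defensive.

Local Open Scope nat_scope.

(** * Separation and intersection numbers *)

Lemma perm_of_equal_fibers (m : nat) (C : eqType) (f g : 'I_m -> C) :
  (forall c, #|[set x | f x == c]| = #|[set x | g x == c]|) ->
  exists s : 'S_m, forall x, g (s x) = f x.
Proof.
move=> fib.
have/tuple_permP[s e] : perm_eq [tuple f i | i < m] [tuple g i | i < m].
  apply/allP => c _ /=; apply/eqP.
  rewrite !count_map.
  move: (fib c); rewrite !cardsE !cardE !size_filter -!enumT => e.
  by rewrite (eq_count (a2 := fun x => f x == c)) // e; apply: eq_count.
exists s => x.
have := congr1 (fun t : seq C => nth (f x) t x) e.
by rewrite -!tnth_nth !tnth_mktuple => ->.
Qed.

(** The stabilizer of [a] is the setwise stabilizer of a subset, so its orbits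
    on subsets of a given size are told apart by the intersection with [a]. *)
Lemma separatesE (m : nat) (a w w' : {set 'I_m}) : #|w| = #|w'| ->
  separates ('P^*)%act [set: 'S_m]%G a w w' = (#|w :&: a| != #|w' :&: a|).
Proof.
move=> eqw; rewrite /separates; congr negb.
apply/orbitP/eqP => [[s] | eqi].
  rewrite inE => /andP[_ /astab1P]; rewrite /= /setact /= => sa <-.
  have injs : injective (fun x : 'I_m => aperm x s) by exact: (act_inj 'P%act s).
  rewrite -[in RHS]sa -(imsetI (f := fun x => aperm x s)) ?card_imset //.
  by move=> x y _ _; apply: injs.
have cell (v : {set 'I_m}) c : #|[set x | ((x \in a), (x \in v)) == c]| =
    (if c.1 then if c.2 then #|v :&: a| else #|a| - #|v :&: a|
     else if c.2 then #|v| - #|v :&: a| else m - (#|a| + #|v| - #|v :&: a|)).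
  have key : [set x | ((x \in a), (x \in v)) == c] =
    (if c.1 then if c.2 then v :&: a else a :\: v
     else if c.2 then v :\: a else ~: (a :|: v)).
    apply/setP => x; case: c => [[] []] /=; rewrite !inE xpair_eqE /=;
    by case: (x \in a); case: (x \in v).
  rewrite key; case: c.1; case: c.2 => //; rewrite ?cardsD //.
    by rewrite setIC.
  by rewrite cardsCs setCK card_ord cardsU (setIC a).
case: (@perm_of_equal_fibers m _ (fun x => ((x \in a), (x \in w)))
        (fun x => ((x \in a), (x \in w')))) => [c | s es].
  by rewrite !cell eqw eqi.
have ea x : (s x \in a) = (x \in a) by case: (es x).
have ew x : (s x \in w') = (x \in w) by case: (es x).
have im (v v' : {set 'I_m}) : (forall x, (s x \in v') = (x \in v)) ->
    ('P^*)%act v s = v'.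
  move=> e; apply/setP => y; rewrite /= /setact /=.
  apply/imsetP/idP => [[x vx ->] | vy]; first by rewrite apermE e.
  by exists ((s^-1)%g y); rewrite ?apermE ?permKV // -e permKV.
exists s; last exact: im.
by rewrite inE in_setT /=; apply/astab1P; apply: im.
Qed.

Lemma separating_ksubsetsP (m k : nat) (S : {set {set 'I_m}}) :
  reflect ((forall a, a \in S -> #|a| = k) /\
           (forall w w' : {set 'I_m}, #|w| = k -> #|w'| = k ->
              (forall a, a \in S -> #|w :&: a| = #|w' :&: a|) -> w = w'))
          (separating ('P^*)%act [set: 'S_m]%G (ksubsets m k) S).
Proof.
apply: (iffP andP) => [[/subsetP sub sep] | [sub sep]]; split.
- by move=> a /sub; rewrite inE => /eqP.
- move=> w w' cw cw' eqi; apply/eqP/negPn/negP => nww'.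
  move/forall_inP/(_ w): sep; rewrite inE cw eqxx => /(_ isT)/forall_inP/(_ w').
  rewrite inE cw' eqxx nww' => /(_ isT)/exists_inP[a Sa].
  by rewrite separatesE ?cw ?cw' // eqi ?eqxx.
- by apply/subsetP => a /sub; rewrite inE => ->.
apply/forall_inP => w; rewrite inE => /eqP cw.
apply/forall_inP => w'; rewrite inE => /eqP cw'.
apply/implyP; apply: contraR => /exists_inPn nsep; apply/eqP; apply: sep => // a.
by move/nsep; rewrite separatesE ?cw ?cw' // negbK => /eqP.
Qed.

(** * The lower bound *)

Lemma subset_of_card (T : finType) (A : {set T}) (n : nat) :
  n <= #|A| -> exists2 B : {set T}, B \subset A & #|B| = n.
Proof.
case/card_geqP => s [us <- sA]; exists [set x in s].
  by apply/subsetP => x; rewrite inE => /sA.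
by rewrite cardsE; apply/card_uniqP.
Qed.

Section LowerBound.

Variables (m k : nat) (S : {set {set 'I_m}}).
Hypothesis size_block : forall a, a \in S -> #|a| = k.
Hypothesis sep : forall w w' : {set 'I_m}, #|w| = k -> #|w'| = k ->
  (forall a, a \in S -> #|w :&: a| = #|w' :&: a|) -> w = w'.

Let col (p : 'I_m) : {set {set 'I_m}} := [set a in S | p \in a].

(** Two disjoint lists of points with the same column sum can be completed by
    common points to two [k]-subsets that are not separated. *)
Lemma no_column_relation (s t : seq 'I_m) :
  uniq (s ++ t) -> size s = size t -> size s <= k -> size s + k <= m ->
  (forall a, a \in S ->
     count (fun p => a \in col p) s = count (fun p => a \in col p) t) ->
  s = [::].
Proof.
move=> ust est sk skm rel.
have [us ut dst] : [/\ uniq s, uniq t & ~~ has [in s] t].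
  by move: ust; rewrite cat_uniq => /and3P[-> -> ->].
pose A := [set x in s]; pose B := [set x in t].
have cA : #|A| = size s by rewrite cardsE; apply/card_uniqP.
have cB : #|B| = size t by rewrite cardsE; apply/card_uniqP.
have AB0 x : x \in s -> x \in t -> False.
  by move=> xs xt; case/hasP: dst; exists x.
have [C sC cC] : exists2 C : {set 'I_m}, C \subset ~: (A :|: B) & #|C| = k - size s.
  apply: subset_of_card; rewrite cardsCs setCK card_ord cardsU cA cB -est; lia.
have nC x : x \in C -> (x \notin s) /\ (x \notin t).
  by move/(subsetP sC); rewrite !inE negb_or => /andP.
have cI (D : {set 'I_m}) (u : seq 'I_m) a : uniq u -> D = [set x in u] ->
    (forall x, x \in C -> x \notin u) -> a \in S ->
    #|(D :|: C) :&: a| = count (fun p => a \in col p) u + #|C :&: a|.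
  move=> uu eD dis Sa; rewrite setIUl cardsU.
  have -> : D :&: a :&: (C :&: a) = set0.
    apply/setP => x; rewrite !inE eD !inE; apply/negP => /andP[/andP[xu _]].
    by case/andP => /dis; rewrite xu.
  rewrite cards0 subn0; congr (_ + _).
  rewrite -size_filter -(card_uniqP (filter_uniq _ uu)).
  by apply: eq_card => x; rewrite eD !inE mem_filter !inE Sa andbC.
have cU (D : {set 'I_m}) (u : seq 'I_m) : uniq u -> D = [set x in u] -> size u = size s ->
    (forall x, x \in C -> x \notin u) -> #|D :|: C| = k.
  move=> uu eD su dis; rewrite cardsU.
  have -> : D :&: C = set0.
    by apply/setP => x; rewrite !inE eD !inE; apply/negP => /andP[xu /dis]; rewrite xu.
  by rewrite cards0 subn0 cC eD cardsE (card_uniqP uu) su subnKC.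
have eAB : A :|: C = B :|: C.
  apply: sep => [||a Sa].
  - by apply: (cU A s) => // x /nC[].
  - by apply: (cU B t) => // x /nC[].
  rewrite (cI A s) ?(cI B t) ?rel //; by move=> x /nC[].
case: s {cI cU cA cC est us sk skm rel ust dst} @A AB0 nC eAB sC => // x s A AB0 nC eAB sC.
have : x \in B :|: C by rewrite -eAB !inE eqxx.
rewrite !inE => /orP[/AB0|/nC[]]; first by case; rewrite mem_head.
by rewrite mem_head.
Qed.

Hypotheses (hk : 3 <= k) (hkm : k < m).

Lemma column_inj : injective col.
Proof.
move=> p p' e; apply/eqP/negPn/negP => npp'.
suff: [:: p] = [::] :> seq 'I_m by [].
apply: (@no_column_relation [:: p] [:: p']) => //=; try lia.
  by rewrite inE npp'.
by move=> a _; rewrite e.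
Qed.

(** Used when [m <= k + 2], where complements are too small for the relations
    between two or three points. *)
Lemma points_le_exp : m <= 2 ^ #|S|.
Proof.
rewrite -card_powerset -{1}(card_ord m) -(card_imset _ column_inj).
apply: subset_leq_card; apply/subsetP => _ /imsetP[p _ ->].
by rewrite inE; apply/subsetP => a; rewrite inE => /andP[].
Qed.

Section FarFromFull.

Hypothesis hkm3 : k + 3 <= m.

Lemma small_relation (s t : seq 'I_m) :
  uniq (s ++ t) -> size s = size t -> size s <= 3 ->
  (forall a, count (fun p => a \in col p) s = count (fun p => a \in col p) t) ->
  s = [::].
Proof.
move=> ust est s3 rel; apply: (@no_column_relation s t) => //.
  exact: leq_trans hk.
by apply: leq_trans hkm3; rewrite addnC leq_add2l.
Qed.

Let deg p := #|col p|.
(** The members of [S] that have a point of degree one. *)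
Let N : {set {set 'I_m}} := [set a in S | [exists p, col p == [set a]]].

Lemma pendantP a : a \in N -> exists p, col p = [set a].
Proof. by rewrite inE => /andP[_ /existsP[p /eqP]]; exists p. Qed.

Lemma card_pendant : #|N| = #|[set p | deg p == 1]|.
Proof.
have -> : [set p | deg p == 1] = [set p | [exists a in N, col p == [set a]]].
  apply/setP => p; rewrite !inE; apply/cards1P/exists_inP => [[a e] | [a _ /eqP e]]; last by exists a.
  exists a; last by rewrite e.
  have : a \in col p by rewrite e set11.
  by rewrite !inE => /andP[-> _]; apply/existsP; exists p; rewrite e.
rewrite -(card_imset _ column_inj) -(card_imset _ (@set1_inj _)).
apply: eq_card => A; apply/imsetP/imsetP => [[a Na ->] | [p]].
  have [p e] := pendantP Na; exists p; last by rewrite e.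
  by rewrite inE; apply/exists_inP; exists a; rewrite ?e.
by rewrite inE => /exists_inP[a Na /eqP e ->]; exists a.
Qed.

Lemma card_deg0 : #|[set p | deg p == 0]| <= 1.
Proof.
rewrite leqNgt; apply/card_gt1P => -[p [p' []]].
rewrite !inE !cards_eq0 => /eqP e /eqP e' /eqP; apply.
by apply: column_inj; rewrite e e'.
Qed.

(** Points of degree two are edges on [S].  There is at most one edge with both ends
    in [N]: of two such edges, each together with the points of degree one on the
    ends of the other has the same column sum. *)
Lemma card_inner_edges :
  #|[set p | (deg p == 2) && (col p \subset N)]| <= 1.
Proof.
have dp p p' : deg p != deg p' -> p != p' by apply: contra => /eqP ->.
rewrite leqNgt; apply/card_gt1P => -[p [p' []]].
rewrite !inE => /andP[/cards2P[a [b [nab ep]]] sp] /andP[/cards2P[c [d [ncd ep']]] sp'] npp'.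
have inN x : (x \in [set a; b]) || (x \in [set c; d]) -> x \in N.
  by case/orP; rewrite -?ep -?ep'; apply: subsetP.
have [qa ea] := pendantP (inN a (introT orP (or_introl (set21 a b)))).
have [qb eb] := pendantP (inN b (introT orP (or_introl (set22 a b)))).
have [qc ec] := pendantP (inN c (introT orP (or_intror (set21 c d)))).
have [qd ed] := pendantP (inN d (introT orP (or_intror (set22 c d)))).
have d2 : deg p = 2 by rewrite /deg ep cards2 nab.
have d2' : deg p' = 2 by rewrite /deg ep' cards2 ncd.
have pq q x r : col q = [set x] -> deg r = 2 -> r != q.
  by move=> e dr; apply: dp; rewrite dr /deg e cards1.
have qq q x q' x' : col q = [set x] -> col q' = [set x'] -> x != x' -> q != q'.
  by move=> e e' nxx'; apply: contra nxx' => /eqP qq'; apply/eqP/set1_inj; rewrite -e -e' qq'.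
(* two edges with a common end x and other ends y, z *)
have share x y z r r' qy qz : y != z -> col r = [set x; y] -> col r' = [set x; z] ->
    col qy = [set y] -> col qz = [set z] -> deg r = 2 -> deg r' = 2 -> r != r' -> False.
  move=> nyz er er' ey ez dr dr' nrr'.
  suff: [:: r; qz] = [::] :> seq 'I_m by [].
  apply: (@small_relation _ [:: r'; qy]) => //=.
    have nzr' : qz != r' by rewrite eq_sym (pq qz z).
    have nzy : qz != qy by rewrite eq_sym (qq _ _ _ _ ey ez).
    by rewrite !inE !negb_or nrr' nzr' nzy (pq qy y r') // (pq qz z r) // (pq qy y r).
  move=> e; rewrite er er' ey ez !inE.
  have nxy : x != y by move: dr; rewrite /deg er cards2; case: (x != y).
  have nxz : x != z by move: dr'; rewrite /deg er' cards2; case: (x != z).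
  case: (eqVneq e x) => [->|_]; first by rewrite (negPf nxy) (negPf nxz).
  by rewrite /= !addn0 addnC.
case: (eqVneq a c) => [eac|nac].
  apply: (share a b d p p' qb qd) => //; rewrite ?ep' ?eac //.
  by apply: contraNneq npp' => ebd; apply/eqP/column_inj; rewrite ep ep' eac ebd.
case: (eqVneq a d) => [ead|nad].
  apply: (share a b c p p' qb qc) => //; rewrite ?ep' ?ead 1?setUC //.
  by apply: contraNneq npp' => ebd; apply/eqP/column_inj; rewrite ep ep' ead ebd setUC.
case: (eqVneq b c) => [ebc|nbc].
  apply: (share b a d p p' qa qd) => //; first by rewrite ep setUC.
  by rewrite ep' ebc.
case: (eqVneq b d) => [ebd|nbd].
  apply: (share b a c p p' qa qc) => //; first by rewrite ep setUC.
  by rewrite ep' ebd setUC.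
suff: [:: p; qc; qd] = [::] :> seq 'I_m by [].
apply: (@small_relation _ [:: p'; qa; qb]) => //=.
  have sy (x y : {set 'I_m}) : x != y -> y != x by rewrite eq_sym.
  have ncp' : qc != p' by rewrite eq_sym (pq qc c).
  have ndp' : qd != p' by rewrite eq_sym (pq qd d).
  have nqca : qc != qa := qq _ _ _ _ ec ea (sy _ _ nac).
  have nqcb : qc != qb := qq _ _ _ _ ec eb (sy _ _ nbc).
  have nqda : qd != qa := qq _ _ _ _ ed ea (sy _ _ nad).
  have nqdb : qd != qb := qq _ _ _ _ ed eb (sy _ _ nbd).
  rewrite !inE !negb_or npp' ncp' ndp' nqca nqcb nqda nqdb.
  rewrite (pq qa a p ea d2) (pq qb b p eb d2) (pq qc c p ec d2) (pq qd d p ed d2).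
  rewrite (pq qa a p' ea d2') (pq qb b p' eb d2').
  by rewrite (qq _ _ _ _ ec ed ncd) (qq _ _ _ _ ea eb nab).
move=> e; rewrite ep ep' ea eb ec ed !inE.
case: (eqVneq e a) => [->|_]; first by rewrite (negPf nab) (negPf nac) (negPf nad).
case: (eqVneq e b) => [->|_]; first by rewrite (negPf nbc) (negPf nbd).
by case: (eqVneq e c) => [->|_]; rewrite ?(negPf ncd) //; case: (e == d).
Qed.

(** An edge that leaves [N] is determined by its end outside [N]: if [{a, b}] and
    [{a', b}] are edges and [a], [a'] are in [N], then the first edge and the point
    of degree one on [a'] have the same column sum as the second edge and the
    point of degree one on [a]. *)
Lemma card_outer_edges :
  #|[set p | (deg p == 2) && (#|col p :&: N| == 1)]| <= #|S| - #|N|.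
Proof.
set P := [set p | _].
have sNS : N \subset S by apply/subsetP => a; rewrite inE => /andP[].
have edge p : p \in P -> exists a b, [/\ a \in N, b \in S :\: N, a != b & col p = [set a; b]].
  rewrite inE => /andP[/cards2P[a [b [nab ep]]] /cards1P[c ec]].
  have sS x : x \in col p -> x \in S by rewrite inE => /andP[].
  have /setIP[cp cN] : c \in col p :&: N by rewrite ec set11.
  have eca : c \in [set a; b] by rewrite -ep.
  have oth x : x \in [set a; b] -> x != c -> x \in S :\: N.
    move=> xab nxc; rewrite inE sS ?ep // andbT; apply: contra nxc => xN.
    by rewrite -in_set1 -ec inE ep xab.
  case/set2P: eca => ec'; move: cN oth; rewrite ec' => cN oth.
    by exists a, b; split => //; apply: oth; rewrite ?set22 // eq_sym.
  exists b, a; split=> //; [by apply: oth; rewrite ?set21|by rewrite eq_sym|by rewrite ep setUC].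
pose out p := odflt set0 [pick b in col p | b \notin N].
have outE p a b : a \in N -> b \in S :\: N -> col p = [set a; b] -> out p = b.
  move=> aN /setDP[_ bN] e; rewrite /out e.
  case: pickP => [x /andP[]|/(_ b)]; last by rewrite set22 bN.
  by case/set2P => -> //; rewrite aN.
rewrite -(setIidPr sNS) -cardsD.
rewrite -(card_in_imset (f := out) (D := P)); last first.
  move=> p p' /edge[a [b [aN bN nab e]]] /edge[a' [b' [aN' bN' nab' e']]].
  rewrite (outE p a b) // (outE p' a' b') // => ebb'.
  apply: column_inj; rewrite e e' -ebb'; congr (_ |: _).
  apply/eqP/negPn/negP => naa'.
  have [q eq] := pendantP aN; have [q' eq'] := pendantP aN'.
  have dp r r' : deg r != deg r' -> r != r' by apply: contra => /eqP ->.
  have d2 : deg p = 2 by rewrite /deg e cards2 nab.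
  have d2' : deg p' = 2 by rewrite /deg e' cards2 nab'.
  have d1 : deg q = 1 by rewrite /deg eq cards1.
  have d1' : deg q' = 1 by rewrite /deg eq' cards1.
  suff: [:: p; q'] = [::] :> seq 'I_m by [].
  apply: (@small_relation _ [:: p'; q]) => //=.
    rewrite !inE !negb_or !(dp p q', dp p q, dp q' p', dp p' q) ?(d2, d2', d1, d1') //= !andbT.
    apply/andP; split.
      by apply: contra naa' => /eqP epp'; apply/eqP;
         move: (set21 a b); rewrite -e epp' e' -ebb' !inE (negPf nab) orbF => /eqP.
    by apply: contra naa' => /eqP eqq'; apply/eqP/set1_inj; rewrite -eq -eq' eqq'.
  move=> x; rewrite e e' eq eq' -ebb' !inE.
  case: (eqVneq x a) => [->|_]; first by rewrite (negPf naa') (negPf nab).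
  by case: (eqVneq x b) => [->|_]; rewrite ?orbT ?orbF //= eq_sym ebb' (negPf nab').
apply: subset_leq_card; apply/subsetP => _ /imsetP[p /edge[a [b [aN bN _ e]]] ->].
by rewrite (outE p a b).
Qed.

Lemma incidences (M : {set {set 'I_m}}) : M \subset S ->
  \sum_(p : 'I_m) #|col p :&: M| = k * #|M|.
Proof.
move=> sM; rewrite mulnC -sum_nat_const.
transitivity (\sum_(a in M) \sum_(p in a) 1); last first.
  by apply: eq_bigr => a /(subsetP sM)/size_block; rewrite sum1_card.
rewrite (exchange_big_dep xpredT) //=; apply: eq_bigr => p _.
rewrite -sum1_card; apply: eq_bigl => a; rewrite !inE.
by case: (boolP (a \in M)) => [/(subsetP sM)->|]; rewrite ?andbF ?andbT.
Qed.

(** Every [a] in [N] has [k - 1 >= 2] points of degree at least two; those of degree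
    two are limited by the previous lemmas, the others are charged to the sum. *)
Lemma pendant_bound :
  3 * #|N| <= #|S| + 2 + \sum_(p : 'I_m | 3 <= deg p) deg p.
Proof.
have sNS : N \subset S by apply/subsetP => a; rewrite inE => /andP[].
have leNS : #|N| <= #|S| by apply: subset_leq_card.
have := incidences sNS; rewrite (bigID (fun p => deg p <= 1)) /=.
have le1 : \sum_(p : 'I_m | deg p <= 1) #|col p :&: N| <= #|N|.
  rewrite card_pendant -sum1_card big_mkcond [X in _ <= X]big_mkcond /=.
  apply: leq_sum => p _; rewrite inE.
  have := subset_leq_card (subsetIl (col p) N); rewrite -/(deg p).
  by case: (deg p) => [|[|d]].
have -> : \sum_(p : 'I_m | ~~ (deg p <= 1)) #|col p :&: N| =
   \sum_(p : 'I_m | deg p == 2) #|col p :&: N| + \sum_(p : 'I_m | 3 <= deg p) #|col p :&: N|.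
  rewrite (bigID (fun p => deg p == 2)) /=; congr (_ + _);
    by apply: eq_bigl => p; case: (deg p) => [|[|[|d]]].
have le3 : \sum_(p : 'I_m | 3 <= deg p) #|col p :&: N| <= \sum_(p : 'I_m | 3 <= deg p) deg p.
  by apply: leq_sum => p _; apply/subset_leq_card/subsetIl.
have le2 : \sum_(p : 'I_m | deg p == 2) #|col p :&: N| <= 2 * 1 + (#|S| - #|N|).
  apply: leq_trans (leq_add (leq_mul (leqnn 2) card_inner_edges) card_outer_edges).
  rewrite -!sum1_card big_distrr /= [X in _ <= X + _]big_mkcond.
  rewrite [X in _ <= _ + X]big_mkcond [X in X <= _]big_mkcond -big_split /=.
  apply: leq_sum => p _; rewrite !inE.
  case: eqP => //= dp.
  have := subset_leq_card (subsetIl (col p) N); rewrite -/(deg p) dp.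
  case ec: #|col p :&: N| => [|[|[|c]]] //= _; first by rewrite leq_addl.
  suff -> : col p \subset N by [].
  by apply/setIidPl/eqP; rewrite eqEcard subsetIl ec -/(deg p) dp.
move=> e; set W := (X in _ <= _ + X).
have : k * #|N| <= #|N| + (2 * 1 + (#|S| - #|N|) + W).
  by rewrite -e; exact: leq_add le1 (leq_add le2 le3).
have : 3 * #|N| <= k * #|N| by rewrite leq_mul2r hk orbT.
move: leNS; move: (#|N|) (#|S|) W => n1 s W. lia.
Qed.

(** Per point, [6 <= 3 * deg p] fails only for degrees 0 and 1, with defects 6
    and 3, and is wasteful by at least [deg p] for degrees from 3 on; the waste
    pays for the sum in [pendant_bound]. *)
Lemma far_lower_bound : 6 * m <= (3 * k + 1) * #|S| + 8.
Proof.
have sSS := incidences (subxx S).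
have sum6 : \sum_(p : 'I_m) 6 + \sum_(p : 'I_m | 3 <= deg p) deg p <=
   3 * \sum_(p : 'I_m) deg p + 6 * #|[set p | deg p == 0]| + 3 * #|[set p | deg p == 1]|.
  rewrite -!sum1_card !big_distrr /= [X in _ + X <= _]big_mkcond.
  rewrite [X in _ <= _ + X + _]big_mkcond [X in _ <= _ + X]big_mkcond.
  rewrite -!big_split /=; apply: leq_sum => p _; rewrite !inE.
  by case: (deg p) => [|[|[|d]]] //=; lia.
move: sum6; rewrite sum_nat_const card_ord -card_pendant.
have -> : \sum_(p : 'I_m) deg p = k * #|S|.
  rewrite -sSS; apply: eq_bigr => p _; rewrite (setIidPl _) //.
  by apply/subsetP => a; rewrite inE => /andP[].
have := card_deg0; have := pendant_bound; lia.
Qed.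

End FarFromFull.

Lemma lower_bound : 6 * m <= (3 * k + 1) * #|S| + 8.
Proof.
case: (leqP (k + 3) m) => [|mk]; first exact: far_lower_bound.
have := points_le_exp.
case: #|S| => [|[|[|s]]] /=; [lia | lia | | nia].
by rewrite (_ : 2 ^ 2 = 4) //; lia.
Qed.

End LowerBound.

(** * Peeling families *)

Definition peels (E : finType) (S : {set {set E}}) (n : nat) : Prop :=
  forall D : {set E}, D != set0 -> #|D| <= n ->
    exists2 A, A \in S & #|D :&: A| = 1.

(** A family with [2 / k] sets per point, in which every nonempty set that can be
    contained in a symmetric difference of two [k]-subsets meets a member in
    exactly one point. *)
Definition block (k N : nat) : Prop :=
  exists (E : finType) (S : {set {set E}}),
    [/\ #|E| = k * N, #|S| <= 2 * N, forall A, A \in S -> #|A| = k & peels S (2 * k)].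

Lemma block0 k : block k 0.
Proof.
exists void, set0; split; rewrite ?cards0 ?card_void ?muln0 //.
  by move=> A; rewrite inE.
by move=> D /set0Pn[[]].
Qed.

Lemma blockD k N1 N2 : block k N1 -> block k N2 -> block k (N1 + N2).
Proof.
move=> [E1 [S1 [c1 s1 k1 p1]]] [E2 [S2 [c2 s2 k2 p2]]].
pose l (A : {set E1}) : {set E1 + E2} := [set inl x | x in A].
pose r (A : {set E2}) : {set E1 + E2} := [set inr x | x in A].
have il : injective (@inl E1 E2) by move=> x y [].
have ir : injective (@inr E1 E2) by move=> x y [].
exists (E1 + E2)%type, ([set l A | A in S1] :|: [set r A | A in S2]); split.
- by rewrite card_sum c1 c2 mulnDr.
- apply: leq_trans (leq_of_leqif (leq_card_setU _ _)) _.
  by rewrite mulnDr leq_add // (leq_trans (leq_imset_card _ _)).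
- by move=> A; rewrite inE => /orP[]/imsetP[B SB ->]; rewrite card_imset ?(k1, k2).
move=> D D0 sD.
pose D1 := [set x | inl x \in D]; pose D2 := [set x | inr x \in D].
have lD : l D1 \subset D by apply/subsetP => _ /imsetP[x xD ->]; move: xD; rewrite inE.
have rD : r D2 \subset D by apply/subsetP => _ /imsetP[x xD ->]; move: xD; rewrite inE.
have D1s : #|D1| <= 2 * k.
  by rewrite -(card_imset _ il); apply: leq_trans (subset_leq_card lD) sD.
have D2s : #|D2| <= 2 * k.
  by rewrite -(card_imset _ ir); apply: leq_trans (subset_leq_card rD) sD.
case: (eqVneq D1 set0) => [D10|D10].
  have D20 : D2 != set0.
    case/set0Pn: D0 => [[x|x] xD]; last by apply/set0Pn; exists x; rewrite inE.
    by move/setP/(_ x): D10; rewrite !inE xD.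
  have [A SA eA] := p2 _ D20 D2s; exists (r A).
    by rewrite inE imset_f ?orbT.
  rewrite -eA -(card_imset _ ir); apply: eq_card => -[x|x]; rewrite !inE.
    by apply/andP/imsetP => [[_ /imsetP[]]//|[y]].
  by rewrite (mem_imset (mem A) x ir) (mem_imset _ x ir) !inE.
have [A SA eA] := p1 _ D10 D1s; exists (l A); first by rewrite inE imset_f.
rewrite -eA -(card_imset _ il); apply: eq_card => -[x|x]; rewrite !inE.
  by rewrite (mem_imset (mem A) x il) (mem_imset _ x il) !inE.
by apply/andP/imsetP => [[_ /imsetP[]]//|[y]].
Qed.

Lemma blockM k N q : block k N -> block k (q * N).
Proof. by move=> b; elim: q => [|q IH]; [exact: block0 | rewrite mulSn; exact: blockD]. Qed.

Lemma odd_symdiff_separates (T : finType) (w w' A : {set T}) :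
  odd #|((w :\: w') :|: (w' :\: w)) :&: A| -> #|w :&: A| != #|w' :&: A|.
Proof.
apply: contraL => /eqP e; rewrite setIUl cardsU.
have -> : (w :\: w') :&: A :&: ((w' :\: w) :&: A) = set0.
  by apply/setP => x; rewrite !inE; case: (x \in w); case: (x \in w'); case: (x \in A).
have cw (u v : {set T}) : #|u :&: A| = #|u :&: v :&: A| + #|(u :\: v) :&: A|.
  rewrite -(cardsID v) setIAC; congr (_ + _); apply: eq_card => x; rewrite !inE.
  by case: (x \in v); case: (x \in u); case: (x \in A).
have := cw w w'; rewrite e (cw w' w) (setIC w') => /eqP.
by rewrite eqn_add2l cards0 subn0 => /eqP ->; rewrite oddD addbb.
Qed.

(** The symmetric difference of two [k]-subsets has at most [2 * k] elements, so
    a set meeting it in one point separates them.  A point outside the blocks is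
    added to a set together with points already recovered. *)
Lemma sigma_le_block m k N r :
  0 < k -> 0 < N -> m = k * N + r -> block k N -> sigma m k <= 2 * N + r.
Proof.
move=> k0 N0 em [E [S [cE cS sS pS]]].
have cm : #|{: E + 'I_r}| = m by rewrite card_sum cE card_ord em.
pose g (x : E + 'I_r) : 'I_m := cast_ord cm (enum_rank x).
pose f (i : 'I_m) : E + 'I_r := enum_val (cast_ord (esym cm) i).
have gK : cancel g f by move=> x; rewrite /f /g cast_ordK enum_rankK.
have fK : cancel f g by move=> x; rewrite /f /g enum_valK cast_ordKV.
have gI : injective g := can_inj gK.
have glI : injective (g \o inl) by move=> x y /gI[].
have [B _ cB] : exists2 B : {set E}, B \subset setT & #|B| = k.-1.
  apply: subset_of_card; rewrite cardsT cE.
  by apply: leq_trans (leq_pred k) _; rewrite leq_pmulr.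
pose L (A : {set E}) : {set 'I_m} := [set (g \o inl) x | x in A].
pose R (p : 'I_r) : {set 'I_m} := g (inr p) |: L B.
pose SS := [set L A | A in S] :|: [set R p | p : 'I_r].
have inL (A : {set E}) x : (x \in L A) = (if f x is inl y then y \in A else false).
  apply/imsetP/idP => [[y yA ->] | ]; first by rewrite /= gK.
  by case ef: (f x) => [y|//] yA; exists y; rewrite //= -ef fK.
have gr p A : g (inr p) \notin L A by rewrite inL gK.
have cSS : #|SS| <= 2 * N + r.
  apply: leq_trans (leq_of_leqif (leq_card_setU _ _)) (leq_add _ _).
    exact: leq_trans (leq_imset_card _ _) cS.
  by apply: leq_trans (leq_imset_card _ _) _; rewrite card_ord.
apply: leq_trans (cSS); apply: orbit_dim_min; apply/separating_ksubsetsP; split.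
  move=> a; rewrite inE => /orP[]/imsetP[A SA ->].
    by rewrite card_imset ?sS.
  by rewrite cardsU1 gr card_imset // cB add1n prednK.
move=> w w' cw cw' eqi; apply/eqP/negPn/negP => nww'.
pose D := (w :\: w') :|: (w' :\: w).
have sD : #|D| <= 2 * k.
  rewrite mul2n -addnn -{1}cw -cw' (leq_trans (leq_of_leqif (leq_card_setU _ _))) //.
  by rewrite leq_add ?subset_leq_card ?subsetDl.
have sepD a : a \in SS -> #|D :&: a| = 1 -> False.
  move=> Sa e1; have := @odd_symdiff_separates _ w w' a.
  by rewrite -/D e1 eqi // eqxx => /(_ isT).
pose D1 := [set x | g (inl x) \in D].
case: (eqVneq D1 set0) => [D10|D10].
  have [x xD] : exists x, x \in D.
    apply/set0Pn; apply: contra nww' => /eqP/setP D0; apply/eqP/setP => x.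
    by move: (D0 x); rewrite !inE; case: (x \in w); case: (x \in w').
  case ef: (f x) => [y|p].
    by move/setP/(_ y): D10; rewrite !inE -ef fK; move: xD; rewrite !inE => ->.
  apply: (sepD (R p)); first by rewrite inE imset_f ?orbT.
  apply/eqP/cards1P; exists (g (inr p)); apply/setP => z; rewrite in_setI in_setU1 in_set1.
  case: eqP => [->|_] /=; first by rewrite -ef fK xD.
  rewrite inL; case ez: (f z) => [y|]; rewrite ?andbF //.
  by move/setP/(_ y): D10; rewrite in_set in_set0 -ez fK => ->.
have D1s : #|D1| <= 2 * k.
  apply: leq_trans sD; rewrite -(card_imset _ glI); apply: subset_leq_card.
  by apply/subsetP => z /imsetP[y yD ->]; move: yD; rewrite in_set.
have [A SA eA] := pS _ D10 D1s.
apply: (sepD (L A)); first by rewrite inE imset_f.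
rewrite -eA -(card_imset _ glI); apply: eq_card => z.
rewrite in_setI inL -/(L (D1 :&: A)) inL; case ez: (f z) => [y|]; rewrite ?andbF //.
have zE : z = g (inl y) by rewrite -ez fK.
by rewrite in_setI zE; congr (_ && _); rewrite [RHS]in_set.
Qed.

(** The [k]-subsets of [k.+1] points determine how a [k]-subset meets these
    points, because it does not contain all of them; every further point needs
    one more set. *)
Lemma sigma_le_degree m k : 0 < k -> k < m -> sigma m k <= m.
Proof.
move=> k0 km.
pose T := [set x : 'I_m | x < k.+1]; pose B := [set x : 'I_m | x < k.-1].
pose F (i : 'I_m) := if i \in T then T :\ i else i |: B.
have cI n : n <= m -> #|[set x : 'I_m | x < n]| = n.
  move=> nm; have wI : injective (widen_ord nm) by move=> x y [] /val_inj.
  rewrite -[RHS]card_ord -(card_imset _ wI).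
  apply: eq_card => x; rewrite inE; apply/idP/imsetP => [xn|[y _ ->]]; last exact: (ltn_ord y).
  by exists (Ordinal xn) => //; apply: val_inj.
have cT : #|T| = k.+1 by apply: cI.
have cB : #|B| = k.-1 by apply: cI; lia.
have BT x : x \in B -> x \in T by rewrite !inE; lia.
pose S := [set F i | i : 'I_m].
have cS : #|S| <= m by rewrite -[X in _ <= X]card_ord; apply: leq_imset_card.
apply: leq_trans (cS); apply: orbit_dim_min; apply/separating_ksubsetsP; split.
  move=> _ /imsetP[i _ ->]; rewrite /F; case: ifP => Ti.
    by have := cardsD1 i T; rewrite Ti cT => -[].
  by rewrite cardsU1 cB; case: (boolP (i \in B)) => [/BT|]; rewrite ?Ti // add1n prednK.
move=> w w' cw cw' eqi.
have eqF i : #|w :&: F i| = #|w' :&: F i| by apply: eqi; apply: imset_f.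
have wT (v : {set 'I_m}) i : i \in T -> #|v :&: T| = (i \in v) + #|v :&: F i|.
  by move=> Ti; rewrite (cardsD1 i) inE Ti andbT /F Ti setIDA.
have full (v : {set 'I_m}) : #|v| = k -> exists2 i, i \in T & i \notin v.
  move=> cv; apply/exists_inP; apply: contraT => /exists_inPn h.
  have : T \subset v by apply/subsetP => i /h; rewrite negbK.
  by move/subset_leq_card; rewrite cT cv ltnn.
have eqT : #|w :&: T| = #|w' :&: T|.
  have [i Ti niw] := full w cw; have [j Tj njw] := full w' cw'.
  apply/eqP; rewrite eqn_leq; apply/andP; split.
    by rewrite (wT w i) // (negPf niw) eqF (wT w' i) // leq_addl.
  by rewrite (wT w' j) // (negPf njw) -eqF (wT w j) // leq_addl.
have onT i : i \in T -> (i \in w) = (i \in w').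
  move=> Ti; have := wT w i Ti; rewrite eqT (wT w' i) // eqF => /eqP.
  by rewrite eqn_add2r; case: (i \in w); case: (i \in w').
apply/setP => i; case: (boolP (i \in T)) => [/onT // | nTi].
have eB : w :&: B = w' :&: B.
  apply/setP => x; rewrite !in_setI; case: (boolP (x \in B)) => [/BT/onT ->|] //.
  by rewrite !andbF.
have wF (v : {set 'I_m}) : #|v :&: F i| = (i \in v) + #|v :&: B|.
  have niB : i \notin B by apply: contra nTi => /BT.
  rewrite /F (negPf nTi) (cardsD1 i) in_setI setU11 andbT; congr (_ + _).
  apply: eq_card => x; rewrite !inE; case: eqP => [->|] //=.
  by move: niB; rewrite inE => /negPf ->; rewrite andbF.
have := eqF i; rewrite !wF eB => /eqP; rewrite eqn_add2r.
by case: (i \in w); case: (i \in w').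
Qed.

(** * Bipartite graphs without short cycles *)

Section Graph.

(** A bipartite multigraph is given by its edges and their two end vertices;
    the side of a vertex is a Boolean. *)
Variables (T : finType) (V : eqType) (f : bool -> T -> V).

(** A step of a walk changes the edge and keeps one end, on alternating sides; a
    cycle of length at most [n] would be a closed walk. *)
Definition no_short_walk (n : nat) : Prop :=
  forall (e : nat -> T) (s : bool) (r : nat), 0 < r <= n ->
    (forall t, t < r -> e t.+1 <> e t /\ f (odd t (+) s) (e t.+1) = f (odd t (+) s) (e t)) ->
    e r <> e 0.

(** In a finite set of edges where no end vertex is a leaf one can walk for
    ever without turning back, and so comes back to an edge already used. *)
Lemma leaf_of_no_short_walk (n : nat) (D : {set T}) :
  no_short_walk n -> D != set0 -> #|D| <= n ->
  exists b, exists2 x, x \in D & forall y, y \in D -> f b y = f b x -> y = x.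
Proof.
move=> nsw /set0Pn[x0 x0D] sD.
case: (boolP [exists b, [exists x in D, [forall y in D, (f b y == f b x) ==> (y == x)]]]).
  case/existsP => b /exists_inP[x xD /forall_inP h]; exists b, x => // y yD e.
  by apply/eqP; move: (h y yD); rewrite e eqxx.
rewrite negb_exists => /forallP nl.
have step b x : x \in D -> exists y, [&& y \in D, y != x & f b y == f b x].
  move=> xD; move/exists_inPn/(_ x xD): (nl b); rewrite negb_forall => /existsP[y].
  by rewrite !negb_imply => h; exists y; case/and3P: h => -> -> ->.
pose nx b x := odflt x [pick y | [&& y \in D, y != x & f b y == f b x]].
have nxP b x : x \in D -> [&& nx b x \in D, nx b x != x & f b (nx b x) == f b x].
  by move=> /(step b)[y hy]; rewrite /nx; case: pickP => [//|/(_ y)]; rewrite hy.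
pose e := fix e t := if t is t'.+1 then nx (odd t') (e t') else x0.
have eD t : e t \in D by elim: t => //= t IH; case/and3P: (nxP (odd t) _ IH).
have [i [j [lij lj eij]]] : exists i j, [/\ i < j, j <= #|D| & e i = e j].
  pose g (i : 'I_#|D|.+1) : {x | x \in D} := exist _ (e i) (eD i).
  have ninj : ~ injective g.
    by move=> gI; have := leq_card g gI; rewrite card_ord card_sig ltnn.
  have : ~~ injectiveb g by apply/injectiveP.
  case/injectivePn => i [j nij [eij]].
  case: (ltngtP i j) => [lij|lji|/val_inj eq]; last by rewrite eq eqxx in nij.
    by exists i, j; split => //; rewrite -ltnS ltn_ord.
  by exists j, i; split => //; rewrite -ltnS ltn_ord.
exfalso; apply: (nsw (fun t => e (i + t)) (odd i) (j - i)).
- by rewrite subn_gt0 lij (leq_trans (leq_subr i j)) // (leq_trans lj).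
- move=> t _; have -> : odd t (+) odd i = odd (i + t) by rewrite oddD addbC.
  rewrite addnS; case/and3P: (nxP (odd (i + t)) _ (eD (i + t))) => _ /eqP h1 /eqP h2.
  by split.
by rewrite subnKC ?(ltnW lij) // addn0.
Qed.

(** The points are the edges of the graph and the sets are the stars of its
    vertices; a leaf of the subgraph [D] is a star that meets [D] in one edge. *)
Lemma block_of_graph (k N : nat) (E : {set T}) :
  0 < k -> #|E| = k * N ->
  (forall b x, x \in E -> #|[set y in E | f b y == f b x]| = k) ->
  no_short_walk (2 * k) -> block k N.
Proof.
move=> k0 cE reg nsw.
pose E' := {x | x \in E}.
pose F b (x : E') : {set E'} := [set y | f b (val y) == f b (val x)].
have cF b x : #|F b x| = k.
  rewrite -[RHS](reg b _ (valP x)) -(card_imset _ val_inj); apply: eq_card => y.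
  rewrite inE; apply/imsetP/andP => [[z zF ->]|[yE fy]].
    by move: zF; rewrite inE => ->; rewrite (valP z).
  by exists (exist _ y yE); rewrite // inE.
pose S b := [set F b x | x : E'].
have cS b : #|S b| = N.
  have part : partition (S b) [set: E'].
    suff -> : S b = preim_partition (fun x : E' => f b (val x)) [set: E'].
      exact: preim_partitionP.
    apply/setP => A; apply/imsetP/imsetP => -[x _ ->]; exists x; rewrite ?inE //;
    by apply/setP => y; rewrite !inE eq_sym.
  have cA : {in S b, forall A : {set E'}, #|A| = k} by move=> _ /imsetP[x _ ->].
  have := card_uniform_partition cA part; rewrite cardsT card_sig cE mulnC => /eqP.
  by rewrite eqn_pmul2r // => /eqP.
exists E', (S false :|: S true); split.
- by rewrite card_sig.
- apply: leq_trans (leq_of_leqif (leq_card_setU _ _)) _.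
  by rewrite !cS mul2n addnn.
- by move=> A; rewrite inE => /orP[]/imsetP[x _ ->].
move=> D D0 sD.
pose D' := [set val x | x in D].
have [||b [x /imsetP[z zD ->] lf]] := @leaf_of_no_short_walk (2 * k) D' nsw.
- by case/set0Pn: D0 => x xD; apply/set0Pn; exists (val x); apply: imset_f.
- by rewrite card_imset //; apply: val_inj.
exists (F b z); first by rewrite inE; case: b {lf}; rewrite imset_f ?orbT.
apply/eqP/cards1P; exists z; apply/setP => y; rewrite !inE.
apply/andP/eqP => [[yD /eqP fy]|->]; last by rewrite eqxx zD.
by apply: val_inj; apply: lf => //; apply: imset_f.
Qed.

End Graph.

Local Open Scope ring_scope.

(** * Regular pieces of a host graph *)

Section Host.

(** The elements of [T] are the edges of a bipartite graph.  The orbits of [X] are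
    the vertices on one side, called points, and the orbits of [Y] those on the
    other side, called lines; [alpha] and [beta] are coordinates along these
    orbits, so that [beta] is a colour of the points and [alpha] of the lines. *)

Variables (F : finFieldType) (T : finType).
Variables (X Y : F -> T -> T) (alpha beta : T -> F).
Hypothesis XD : forall a b g, X a (X b g) = X (a + b) g.
Hypothesis YD : forall a b g, Y a (Y b g) = Y (a + b) g.
Hypothesis X0 : forall g, X 0 g = g.
Hypothesis Y0 : forall g, Y 0 g = g.
Hypothesis alphaX : forall a g, alpha (X a g) = alpha g + a.
Hypothesis betaX : forall a g, beta (X a g) = beta g.
Hypothesis alphaY : forall a g, alpha (Y a g) = alpha g.
Hypothesis betaY : forall a g, beta (Y a g) = beta g + a.

Variable k : nat.
Hypothesis k_gt0 : (0 < k)%N.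

Hypothesis no_relation : forall (h : nat -> T) (s : bool) (r : nat), (0 < r <= 2 * k)%N ->
  (forall t, (t < r)%N ->
     exists2 a : F, a != 0 & h t.+1 = (if odd t (+) s then Y else X) a (h t)) ->
  h r <> h 0%N.

(* a vertex is represented by its edge at which the moving coordinate is 0 *)
Let f (b : bool) (g : T) : T := if b then Y (- beta g) g else X (- alpha g) g.
Let L : nat := #|[set g | (alpha g == 0) && (beta g == 0)]|.

Lemma sameX g g' : f false g' = f false g -> g' = X (alpha g' - alpha g) g.
Proof.
rewrite /f => e; have := congr1 (X (alpha g')) e.
by rewrite !XD subrr X0.
Qed.

Lemma sameY g g' : f true g' = f true g -> g' = Y (beta g' - beta g) g.
Proof.
rewrite /f => e; have := congr1 (Y (beta g')) e.
by rewrite !YD subrr Y0.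
Qed.

Lemma fX a g : f false (X a g) = f false g.
Proof. by rewrite /f alphaX XD opprD subrK. Qed.

Lemma fY a g : f true (Y a g) = f true g.
Proof. by rewrite /f betaY YD opprD subrK. Qed.

Lemma host_no_short_walk : no_short_walk f (2 * k).
Proof.
move=> e s r r2k step; apply: (no_relation (s := s) r2k) => t tr.
have [ne] := step t tr; case: (odd t (+) s) => fe.
  exists (beta (e t.+1) - beta (e t)); last exact: sameY.
  by apply/eqP => d0; apply: ne; rewrite (sameY fe) d0 Y0.
exists (alpha (e t.+1) - alpha (e t)); last exact: sameX.
by apply/eqP => d0; apply: ne; rewrite (sameX fe) d0 X0.
Qed.

Lemma card_alpha0 (R : {set F}) :
  #|[set g | (alpha g == 0) && (beta g \in R)]| = (#|R| * L)%N.
Proof.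
rewrite /L -cardsX.
pose h (u : F * T) := Y u.1 u.2.
rewrite -(card_in_imset (f := h)).
  apply: eq_card => g; rewrite inE; apply/andP/imsetP => [[ag bg]|[[b g'] ]].
    exists (beta g, Y (- beta g) g); last by rewrite /h /= YD subrr Y0.
    by rewrite !inE bg alphaY ag betaY subrr eqxx.
  by rewrite !inE /= => /andP[bR /andP[/eqP a0 /eqP b0]] ->; rewrite /h /= alphaY a0 betaY b0 add0r.
move=> [b g] [b' g']; rewrite !inE /h /=.
move=> /andP[_ /andP[_ /eqP b0]] /andP[_ /andP[_ /eqP b0']] e.
have eb : b = b' by move/(congr1 beta): e; rewrite !betaY b0 b0' !add0r.
by move/(congr1 (Y (- b))): e; rewrite eb !YD addNr !Y0 => ->.
Qed.

Section Kept.

Variables (La R : {set F}) (kept : pred T).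
Let nP p := #|[set a in La | kept (X a p)]|.
Let nL l := #|[set b in R | kept (Y b l)]|.
Let E : {set T} := [set g | [&& alpha g \in La, beta g \in R & kept g]].

(** If every vertex has degree 0 or [k] in a set of edges, the vertices of degree 0
    can be dropped; [N] counts the remaining points. *)
Lemma block_of_kept (N : nat) :
  (forall p, alpha p = 0 -> beta p \in R -> nP p = 0%N \/ nP p = k) ->
  (forall l, beta l = 0 -> alpha l \in La -> nL l = 0%N \/ nL l = k) ->
  #|[set p | [&& alpha p == 0, beta p \in R & nP p != 0%N]]| = N ->
  block k N.
Proof.
move=> hP hL hN.
have fibP x : beta x \in R -> #|[set y in E | f false y == f false x]| = nP (f false x).
  move=> bR; have inj : injective (fun a => X a (f false x)).
    by move=> a b /(congr1 alpha); rewrite !alphaX => /addrI.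
  rewrite /nP -[RHS](card_imset _ inj); apply: eq_card => y.
  rewrite !inE; apply/andP/imsetP => [[/and3P[aL bR' ky] /eqP e]|[a]].
    exists (alpha y); rewrite ?inE -?e /f XD subrr X0 //.
    by rewrite aL.
  rewrite inE => /andP[aL ka] ->; rewrite fX ka andbT; split; last by rewrite {2}/f fX.
  by rewrite /f !alphaX !betaX subrr add0r aL bR.
have fibL x : alpha x \in La -> #|[set y in E | f true y == f true x]| = nL (f true x).
  move=> aL; have inj : injective (fun a => Y a (f true x)).
    by move=> a b /(congr1 beta); rewrite !betaY => /addrI.
  rewrite /nL -[RHS](card_imset _ inj); apply: eq_card => y.
  rewrite !inE; apply/andP/imsetP => [[/and3P[aL' bR ky] /eqP e]|[a]].
    exists (beta y); rewrite ?inE -?e /f YD subrr Y0 //.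
    by rewrite bR.
  rewrite inE => /andP[bR ka] ->; rewrite fY ka andbT; split; last by rewrite {2}/f fY.
  by rewrite /f !alphaY !betaY subrr add0r aL bR.
apply: (@block_of_graph T T f k N E) => //; last exact: host_no_short_walk.
  rewrite -sum1_card (partition_big (f false)
    (fun p => [&& alpha p == 0, beta p \in R & nP p != 0%N])) /=; last first.
    move=> g gE; move: (gE); rewrite inE => /and3P[aL bR kg].
    rewrite /f alphaX subrr eqxx betaX bR /= -lt0n; apply/card_gt0P.
    by exists (alpha g); rewrite inE aL XD subrr X0.
  rewrite mulnC -hN -sum_nat_const; apply: eq_big => [p|p /and3P[/eqP a0 bR np]].
    by rewrite inE.
  rewrite sum1dep_card.
  have ep : f false p = p by rewrite /f a0 oppr0 X0.
  transitivity (nP p); last by case: (hP p a0 bR) np => -> //; rewrite eqxx.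
  by rewrite -{2}ep -fibP //; apply: eq_card => y; rewrite !inE ep.
move=> b x xE; have fx : x \in [set y in E | f b y == f b x] by rewrite inE xE eqxx.
have pos : #|[set y in E | f b y == f b x]| != 0%N.
  by rewrite -lt0n; apply/card_gt0P; exists x.
move: xE pos; rewrite inE => /and3P[aL bR kx]; case: b {fx}.
  rewrite fibL // => np; case: (hL (f true x)) => [||e|] //; last by rewrite e in np.
    by rewrite /f betaY subrr.
  by rewrite /f alphaY.
rewrite fibP // => np; case: (hP (f false x)) => [||e|] //; last by rewrite e in np.
  by rewrite /f alphaX subrr.
by rewrite /f betaX.
Qed.

End Kept.

Lemma subset_of_field (n : nat) : (n <= #|F|)%N -> exists A : {set F}, #|A| = n.
Proof. by rewrite -cardsT => /subset_of_card[A _ cA]; exists A. Qed.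

(** With [k] colours on each side all the edges between coloured vertices are
    kept. *)
Lemma block_fixed : (k <= #|F|)%N -> block k (k * L).
Proof.
case/subset_of_field => A cA.
have cAk : #|[set a in A | true]| = k by rewrite -cA; apply: eq_card => a; rewrite inE andbT.
apply: (@block_of_kept A A predT) => [p _ _|l _ _|].
- by right.
- by right.
rewrite -cA -card_alpha0; apply: eq_card => p; rewrite !inE.
by rewrite cAk -lt0n k_gt0 andbT.
Qed.

(** The edges with both colours zero; [turn a] follows the closed walk of the
    complete bipartite graph of the colours through the colours [0] and [a]. *)
Definition corner (g : T) : bool := (alpha g == 0) && (beta g == 0).
Definition turn (a : F) (g : T) : T := X (- a) (Y (- a^-1) (X a (Y a^-1 g))).

Lemma corner_turn a g : corner g -> corner (turn a g).
Proof.
move=> /andP[/eqP a0 /eqP b0]; rewrite /corner /turn !(alphaX, alphaY, betaX, betaY) a0 b0.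
by rewrite !add0r !subrr !eqxx.
Qed.

Section Removal.

(** With the [k.+1] colours [0] and [I] for the lines, and their inverses for the
    points, every vertex has to lose an edge.  The edges with [beta = alpha^-1] (in
    particular the corners) form a perfect matching that could be deleted.  On the
    closed walk of [turn a] the edges at the colours [(0, 0)] and [(a, a^-1)] can be
    exchanged with those at [(0, a^-1)] and [(a, 0)]: [AL a] marks the lines of
    colour 0 and [AP a] the points of colour 0 where this is done, which requires
    [AP a (turn a g) = AL a g].  A vertex of colour 0 for which all exchanges are
    made loses all its edges and disappears; these are [OP] and [OL].  [K] tells
    which corners are kept. *)
Variables (I : {set F}) (AL AP : F -> pred T) (OL OP K : pred T).
Hypotheses (I0 : 0 \notin I) (cI : #|I| = k).
Hypothesis ALP : forall a g, a \in I -> corner g -> AP a (turn a g) = AL a g.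
Hypothesis hP : forall g, corner g ->
  if OP g then (forall a, a \in I -> AP a g) /\ K g = false
  else #|[set a in I | AP a g]| = K g.
Hypothesis hL : forall g, corner g ->
  if OL g then (forall a, a \in I -> AL a g) /\ K g = false
  else #|[set a in I | AL a g]| = K g.

Let La := 0 |: I.
Let R := [set a^-1 | a in La].
Let kept (g : T) : bool :=
  if alpha g == 0 then
    if beta g == 0 then K g else ~~ AL (beta g)^-1 (Y (- beta g) g)
  else if beta g == 0 then ~~ AP (alpha g) (X (- alpha g) g)
  else (alpha g == (beta g)^-1) ==> AL (alpha g) (Y (- beta g) (X (- alpha g) g)).

Lemma in_R b : (b \in R) = (b^-1 \in La).
Proof.
apply/imsetP/idP => [[a aL ->]|bL]; first by rewrite invrK.
by exists b^-1; rewrite ?invrK.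
Qed.

Lemma card_colours : #|La| = k.+1.
Proof. by rewrite cardsU1 I0 cI. Qed.

Lemma card_colours' : #|R| = k.+1.
Proof. by rewrite card_imset ?card_colours //; apply: invr_inj. Qed.

(* [b] is the bit of the colour zero, [P] the forbidden colours in [I] *)
Lemma card_split (b : bool) (P : pred F) :
  #|[set a in La | if a == 0 then b else ~~ P a]| = (b + (k - #|[set a in I | P a]|))%N.
Proof.
rewrite (cardsD1 0) !inE eqxx /=; congr (_ + _)%N.
have -> : [set a in I | P a] = I :&: [set a | P a] by apply/setP => a; rewrite !inE.
rewrite -cI -(cardsID [set a | P a] I) addKn.
apply: eq_card => a; rewrite !inE; case: eqVneq => [->|] /=; last by rewrite andbC.
by rewrite (negPf I0) andbF.
Qed.

Lemma count_point p : corner p ->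
  #|[set a in La | kept (X a p)]| = if OP p then 0%N else k.
Proof.
move=> cp; have /andP[/eqP a0 /eqP b0] := cp.
have -> : [set a in La | kept (X a p)] = [set a in La | if a == 0 then K p else ~~ AP a p].
  apply/setP => a; rewrite !inE; congr (_ && _).
  rewrite /kept alphaX betaX a0 b0 add0r eqxx; case: eqP => [->|_]; first by rewrite X0.
  by rewrite XD addNr X0.
rewrite card_split; have := hP cp; case: ifP => [_ [hA ->]|_ ->].
  suff -> : [set a in I | AP a p] = I by rewrite cI subnn.
  by apply/setP => a; rewrite inE; case: (boolP (a \in I)) => // /hA.
by rewrite subnKC //; case: (K p).
Qed.

Lemma count_line l : corner l ->
  #|[set b in R | kept (Y b l)]| = if OL l then 0%N else k.
Proof.
move=> cl; have /andP[/eqP a0 /eqP b0] := cl.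
have -> : [set b in R | kept (Y b l)] =
  [set a^-1 | a in [set a in La | if a == 0 then K l else ~~ AL a l]].
  apply/setP => b; rewrite !inE in_R -{3}(invrK b) mem_imset; last exact: invr_inj.
  rewrite !inE; congr (_ && _).
  rewrite /kept alphaY betaY a0 b0 add0r eqxx invr_eq0; case: eqP => [->|_]; first by rewrite Y0.
  by rewrite YD addNr Y0.
rewrite card_imset; last exact: invr_inj.
rewrite card_split; have := hL cl; case: ifP => [_ [hA ->]|_ ->].
  suff -> : [set a in I | AL a l] = I by rewrite cI subnn.
  by apply/setP => a; rewrite inE; case: (boolP (a \in I)) => // /hA.
by rewrite subnKC //; case: (K l).
Qed.

(* exactly one of the colours 0 and c is missing *)
Lemma card_exchange (c : F) (b : bool) : c \in I ->
  #|[set a in La | if a == 0 then ~~ b else (a == c) ==> b]| = k.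
Proof.
move=> cIn; have c0 : c != 0 by apply: contraNneq I0 => <-.
have := card_split (~~ b) (fun a => (a == c) && ~~ b).
have -> : [set a in La | if a == 0 then ~~ b else ~~ ((a == c) && ~~ b)] =
   [set a in La | if a == 0 then ~~ b else (a == c) ==> b].
  by apply/setP => a; rewrite !inE negb_and negbK implybE.
move=> ->; case: b => /=.
  rewrite (_ : [set _ in _ | _] = set0) ?cards0 ?subn0 //.
  by apply/setP => a; rewrite !inE !andbF.
rewrite (_ : [set _ in _ | _] = [set c]) ?cards1 ?subn1 ?add1n ?prednK //.
by apply/setP => a; rewrite !inE andbT; case: eqP => [->|]; rewrite ?cIn ?andbF.
Qed.

Lemma count_point' p : alpha p = 0 -> beta p \in R -> beta p != 0 ->
  #|[set a in La | kept (X a p)]| = k.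
Proof.
rewrite in_R => a0 bR nb0; have nb0' : (beta p)^-1 != 0 by rewrite invr_eq0.
have bI : (beta p)^-1 \in I by move: bR; rewrite !inE (negPf nb0').
rewrite -[RHS](card_exchange (AL (beta p)^-1 (Y (- beta p) p)) bI).
apply: eq_card => a; rewrite !inE; congr (_ && _).
rewrite /kept alphaX betaX a0 add0r (negPf nb0); case: eqP => [->|_]; first by rewrite X0.
by rewrite XD addNr X0; case: eqP => // ->.
Qed.

Lemma count_line' l : beta l = 0 -> alpha l \in La -> alpha l != 0 ->
  #|[set b in R | kept (Y b l)]| = k.
Proof.
move=> b0 aL na0; have aI : alpha l \in I by move: aL; rewrite !inE (negPf na0).
set a := alpha l in aI na0.
pose g := Y (- a^-1) (X (- a) (Y a^-1 l)).
have cg : corner g.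
  by rewrite /corner /g !(alphaX, alphaY, betaX, betaY) b0 -/a add0r !subrr !eqxx.
have tg : turn a g = X (- a) l.
  by rewrite /turn /g YD subrr Y0 XD subrr X0 YD addNr Y0.
rewrite -[RHS](card_exchange (AP a (X (- a) l)) aI) -[RHS](card_imset _ (@invr_inj F)).
apply: eq_card => b; rewrite !inE in_R -{3}(invrK b) mem_imset; last exact: invr_inj.
rewrite !inE; congr (_ && _).
rewrite /kept alphaY betaY b0 add0r -/a (negPf na0) invr_eq0; case: eqP => [->|_].
  by rewrite Y0.
rewrite eq_sym; case: eqP => //= eb; rewrite -tg ALP //; congr AL.
by rewrite /g -eb invrK.
Qed.

(** All vertices keep [k] edges, except that those of [OP] and [OL] keep none. *)
Lemma block_of_removal : block k (k.+1 * L - #|[set g | corner g && OP g]|).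
Proof.
have sub : [set g | corner g && OP g] \subset [set g | (alpha g == 0) && (beta g \in R)].
  apply/subsetP => g; rewrite !inE => /andP[/andP[-> /eqP ->] _]; rewrite in_R invr0.
  by rewrite !inE eqxx.
apply: (@block_of_kept La R kept) => [p a0 bR|l b0 aL|].
- case: (eqVneq (beta p) 0) => [b0|nb0]; last by right; apply: count_point'.
  by rewrite count_point; [case: (OP p); [left|right] | rewrite /corner a0 b0 eqxx].
- case: (eqVneq (alpha l) 0) => [a0|na0]; last by right; apply: count_line'.
  by rewrite count_line; [case: (OL l); [left|right] | rewrite /corner a0 b0 eqxx].
rewrite -card_colours' -card_alpha0 -(setIidPr sub) -cardsD.
apply: eq_card => p; rewrite !inE.
case: (eqVneq (alpha p) 0) => [a0|na0]; last by rewrite /= andbF.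
case: (boolP (beta p \in R)) => [bR|_] /=; last by rewrite andbF.
case: (eqVneq (beta p) 0) => [b0|nb0].
  have cp : corner p by rewrite /corner a0 b0 eqxx.
  by rewrite count_point // cp /=; case: (OP p) => //; rewrite -lt0n k_gt0.
by rewrite count_point' // -lt0n k_gt0 /corner (negPf nb0) andbF.
Qed.

End Removal.

Section Translations.

(** Two further coordinates of the corners, on which [turn a] acts by the
    translation [(-1, a)]. *)
Variables (c2 c3 : T -> F).
Hypothesis c2_turn : forall (a : F) g, a != 0 -> corner g -> c2 (turn a g) = c2 g - 1.
Hypothesis c3_turn : forall (a : F) g, a != 0 -> corner g -> c3 (turn a g) = c3 g + a.

Lemma index_set : (k < #|F|)%N -> exists I : {set F}, 0 \notin I /\ #|I| = k.
Proof.
move=> kF; have [I sI cI] : exists2 I : {set F}, I \subset [set~ 0] & #|I| = k.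
  by apply: subset_of_card; rewrite cardsC1; case: #|F| kF.
by exists I; split => //; apply/negP => /(subsetP sI); rewrite !inE eqxx.
Qed.

(** Since all [turn a] move [c2] by [-1], the vertices in whole slices of [c2] can
    be deleted by the same exchanges for all colours. *)
Lemma block_slices (C : {set F}) : (k < #|F|)%N ->
  block k (k.+1 * L - #|[set g | corner g && (c2 g + 1 \in C)]|).
Proof.
case/index_set => I [I0 cI].
apply: (@block_of_removal I (fun=> fun g => c2 g \in C) (fun=> fun g => c2 g + 1 \in C)
          (fun g => c2 g \in C) _ pred0) => // [a g aI cg|g cg|g cg].
- by rewrite c2_turn ?subrK //; apply: contraNneq I0 => <-.
- case: ifP => //= e; apply/eqP; rewrite cards_eq0; apply/eqP/setP => a.
  by rewrite in_set in_set0 /= e andbF.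
- case: ifP => //= e; apply/eqP; rewrite cards_eq0; apply/eqP/setP => a.
  by rewrite in_set in_set0 /= e andbF.
Qed.

Variable p : nat.
Hypothesis charF : p \in [pchar F].
Hypothesis turn_order : forall (a : F) g, a != 0 -> corner g -> iter p (turn a) g = g.

(** The orbits under [turn a] and [turn a'] of two corners on which [c2] and [c3]
    vanish can only meet in one of these corners, since [turn a] translates
    [(c2, c3)] by [(-1, a)]. *)
Lemma block_flexible (y : nat) : (k < #|F|)%N ->
  (y <= #|[set g | [&& corner g, (c2 g == 0)%R & (c3 g == 0)%R]]|)%N ->
  block k (k.+1 * L - y).
Proof.
move=> /index_set[I [I0 cI]] /subset_of_card[Om sOm <-].
have In0 a : a \in I -> a != 0 by move=> aI; apply: contraNneq I0 => <-.
have OmP g : g \in Om -> [/\ corner g, c2 g = 0 & c3 g = 0].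
  by move/(subsetP sOm); rewrite inE => /and3P[? /eqP ? /eqP ?].
have p0 : (0 < p)%N by apply: prime_gt0; exact: pcharf_prime charF.
pose A (a : F) (g : T) := [exists n : 'I_p, iter n (turn a) g \in Om].
have itc n a g : corner g -> corner (iter n (turn a) g).
  by move=> cg; elim: n => //= n; apply: corner_turn.
have it2 n a g : a != 0 -> corner g -> c2 (iter n (turn a) g) = c2 g - n%:R.
  move=> a0 cg; elim: n => [|n IH]; first by rewrite subr0.
  by rewrite iterS c2_turn ?itc // IH -natr1 opprD addrA.
have it3 n a g : a != 0 -> corner g -> c3 (iter n (turn a) g) = c3 g + n%:R * a.
  move=> a0 cg; elim: n => [|n IH]; first by rewrite mul0r addr0.
  by rewrite iterS c3_turn ?itc // IH -natr1 mulrDl mul1r addrA.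
have A_turn a g : a \in I -> corner g -> A a (turn a g) = A a g.
  move=> /In0 a0 cg; apply/existsP/existsP => -[n].
    rewrite -iterSr; case: (ltnP n.+1 p) => [np|pn].
      by move=> h; exists (Ordinal np).
    have -> : n.+1 = p by apply/eqP; rewrite eqn_leq pn ltn_ord.
    by rewrite turn_order // => h; exists (Ordinal p0).
  case: n => -[|n] np /= h; last first.
    by exists (Ordinal (ltnW np)); rewrite /= -iterSr.
  have p1 : (p.-1 < p)%N by rewrite prednK.
  by exists (Ordinal p1); rewrite /= -iterSr prednK // turn_order.
have A_Om a g : g \in Om -> A a g by move=> h; apply/existsP; exists (Ordinal p0).
have A_unique a a' g : a \in I -> a' \in I -> corner g -> g \notin Om ->
    A a g -> A a' g -> a = a'.
  move=> /In0 a0 /In0 a0' cg nOm /existsP[n hn] /existsP[n' hn'].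
  have [_ e2 e3] := OmP _ hn; have [_ e2' e3'] := OmP _ hn'.
  move: e2 e2' e3 e3'; rewrite !it2 ?it3 // => /eqP; rewrite subr_eq0 => /eqP -> /eqP.
  rewrite subr_eq0 => /eqP enn /eqP; rewrite addr_eq0 => /eqP -> /eqP.
  rewrite enn addrC subr_eq0 => /eqP /esym; apply: mulfI.
  apply: contraNneq nOm => n0; have : (p %| n')%N by rewrite (dvdn_pcharf charF) n0.
  case: n' hn' {enn n0} => -[|n'] np' //= hn' /dvdn_leq => /(_ isT).
  by rewrite leqNgt np'.
pose K g := (g \notin Om) && [exists a in I, A a g].
have cond g : corner g -> if g \in Om then (forall a, a \in I -> A a g) /\ K g = false
    else #|[set a in I | A a g]| = K g.
  move=> cg; rewrite /K; case: (boolP (g \in Om)) => [gOm|nOm] /=.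
    by split => // a _; apply: A_Om.
  case: exists_inP => [[a aI Aa]|no] /=.
    apply/eqP/cards1P; exists a; apply/setP => a'; rewrite !inE.
    by apply/andP/eqP => [[a'I Aa']|->] //; apply: (A_unique _ _ g).
  by apply/eqP; rewrite cards_eq0; apply/eqP/setP => a; rewrite !inE; apply/negP => /andP[aI Aa]; apply: no; exists a.
have -> : Om = [set g | corner g && (g \in Om)].
  by apply/setP => g; rewrite inE; case: (boolP (g \in Om)) => [/OmP[-> //]|_]; rewrite andbF.
exact: (@block_of_removal I A A (mem Om) (mem Om) K).
Qed.

End Translations.

End Host.

(** * The host graph *)

(** Consider 2x2 matrices over [F[x]] whose diagonal entries are even and whose
    off-diagonal entries are odd polynomials.  A row can be stored as one sequence
    of coefficients, the parity of the degree telling the column. *)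
Section Shift.

Variable F : fieldType.
Implicit Types (U V f : nat -> F) (s e : bool) (c : F) (d : nat).

(** Adding [c * x] times one column to the other, which is a multiplication by an
    elementary matrix; the parity [e] selects the column that changes. *)
Definition shift e c f d : F :=
  f d + (if (0 < d)%N && (odd d == e) then c * f d.-1 else 0).

Lemma shiftS e c f d : shift e c f d.+1 = f d.+1 + (if ~~ odd d == e then c * f d else 0).
Proof. by []. Qed.

Lemma shift_id e c f d : odd d != e -> shift e c f d = f d.
Proof. by rewrite /shift => /negPf ->; rewrite andbF addr0. Qed.

Lemma shiftD n e a b f f' : (forall d, (d <= n)%N -> f' d = shift e b f d) ->
  forall d, (d <= n)%N -> shift e a f' d = shift e (a + b) f d.
Proof.
move=> h [|d] dn; first by rewrite /shift /= h // /shift /= !addr0.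
have dn' := ltnW dn; rewrite !shiftS !h ?shiftS //; case: (eqVneq (~~ odd d) e) => [<-|_]; last by rewrite !addr0.
rewrite shift_id; last by case: (odd d).
by rewrite mulrDl -addrA (addrC (b * _)).
Qed.

Lemma shift0 e f d : shift e 0 f d = f d.
Proof. by rewrite /shift mul0r; case: ifP; rewrite addr0. Qed.

(** With [U] and [V] the coefficients of the two rows of a matrix [g] (the
    off-diagonal entries have odd degree, the diagonal entries even degree), and
    likewise for [h], these are the coefficients of the first row of the product
    of the adjugate of [g] with [h]. *)
Definition phi_term U V U' V' (i j : nat) : F :=
  if odd i then - (U i * V' j) else V i * U' j.
Definition phi U V U' V' d : F := \sum_(i < d.+1) phi_term U V U' V' i (d - i).

Lemma phi_shift U V U' V' s c d :
  phi U V (shift (~~ s) c U') (shift s c V') d = shift (~~ s) c (phi U V U' V') d.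
Proof.
have term i j : phi_term U V (shift (~~ s) c U') (shift s c V') i j.+1 =
   phi_term U V U' V' i j.+1 +
   (if odd (i + j).+1 == ~~ s then c * phi_term U V U' V' i j else 0).
  rewrite /phi_term !shiftS /= oddD.
  by case: (odd i); case: (odd j); case: s; rewrite /= ?addr0 //; ring.
have term0 i : phi_term U V (shift (~~ s) c U') (shift s c V') i 0 = phi_term U V U' V' i 0.
  by rewrite /phi_term /shift /= !addr0.
case: d => [|d].
  by rewrite /shift /phi !big_ord_recl !big_ord0 term0 !addr0.
rewrite shiftS /phi big_ord_recr [in RHS]big_ord_recr /= subnn term0.
rewrite addrAC; congr (_ + _); rewrite (eq_bigr (fun i : 'I_d.+1 => phi_term U V U' V' i (d.+1 - i) +
   (if ~~ odd d == ~~ s then c * phi_term U V U' V' i (d - i) else 0))).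
  rewrite big_split /=; congr (_ + _); case: ifP => _; first by rewrite -mulr_sumr.
  by rewrite big1.
by move=> i _; rewrite subSn ?term ?subnKC //= -ltnS.
Qed.

Lemma phi_odd U V d : odd d -> phi U V U V d = 0.
Proof.
move=> od; pose A (i : 'I_d.+1) := if odd i then 0 else V i * U (d - i)%N.
pose B (i : 'I_d.+1) := if odd i then U i * V (d - i)%N else 0.
rewrite /phi (eq_bigr (fun i => A i - B i)); last first.
  by move=> i _; rewrite /phi_term /A /B; case: ifP; rewrite ?sub0r ?subr0.
rewrite big_split /= sumrN [X in _ - X](reindex_inj rev_ord_inj) /=.
apply/eqP; rewrite subr_eq0; apply/eqP; apply: eq_bigr => i _.
rewrite /A /B /= subSS subKn -1?ltnS // oddB -1?ltnS // od.
by case: (odd i); rewrite //= mulrC.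
Qed.

(** The coefficients of the determinant of the matrix with rows [U] and [V]. *)
Definition detc U V d : F := \sum_(i < d.+1) (-1) ^+ i * (V i * U (d - i)%N).

Lemma phi_even U V d : ~~ odd d -> phi U V U V d = detc U V d.
Proof.
move=> ed; pose A (i : 'I_d.+1) := if odd i then 0 else V i * U (d - i)%N.
pose B (i : 'I_d.+1) := if odd i then U i * V (d - i)%N else 0.
rewrite /phi (eq_bigr (fun i => A i - B i)); last first.
  by move=> i _; rewrite /phi_term /A /B; case: ifP; rewrite ?sub0r ?subr0.
rewrite big_split /= sumrN [X in _ - X](reindex_inj rev_ord_inj) /= -sumrN -big_split /=.
apply: eq_bigr => i _; rewrite /A /B /= subSS subKn -1?ltnS // oddB -1?ltnS // (negPf ed).
rewrite -signr_odd; case: (odd i); rewrite /= ?expr1 ?expr0 ?mul1r ?subr0 //.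
by rewrite sub0r mulN1r mulrC.
Qed.

Lemma detc_shift U V s c d : ~~ odd d ->
  detc (shift (~~ s) c U) (shift s c V) d = detc U V d.
Proof.
move=> ed; pose E1 i := if (0 < i)%N && (odd i == s) then (-1) ^+ i * (c * V i.-1 * U (d - i)%N) else 0.
pose E2 i := if (i < d)%N && (odd i != s) then (-1) ^+ i * (c * V i * U (d - i).-1) else 0.
have term (i : 'I_d.+1) : (-1) ^+ i * (shift s c V i * shift (~~ s) c U (d - i)%N) =
    (-1) ^+ i * (V i * U (d - i)%N) + E1 i + E2 i.
  have id : (i <= d)%N by rewrite -ltnS.
  rewrite /shift /E1 /E2 subn_gt0 oddB // (negPf ed) /= (eq_sym _ (~~ s)).
  have -> : (~~ s == odd i) = (odd i != s) by case: (odd i); case: (s).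
  case: (odd i == s) => /=; rewrite ?andbT ?andbF ?addr0.
    by case: ifP => _; ring.
  by case: ifP => _; ring.
rewrite /detc (eq_bigr _ (fun i _ => term i)) !big_split /= -addrA.
rewrite -[RHS]addr0; congr (_ + _).
have E10 : E1 0%N = 0 by [].
have E2d : E2 d = 0 by rewrite /E2 ltnn.
rewrite big_ord_recl [X in _ + X]big_ord_recr /= E10 E2d add0r addr0.
rewrite -big_split big1 //= => i _; rewrite /E1 /E2 /bump /= add1n ltn_ord /= subnS.
by rewrite (_ : (~~ odd i == s) = (odd i != s)); [case: ifP => _; rewrite ?addr0 // exprS; ring | case: (odd i); case: (s)].
Qed.

(** The top degree of the first row of a reduced alternating word of length [t]
    is [t], or [t - 1] when the first letter does not act on [e_0]. *)
Lemma alternating_top (k : nat) (ph : nat -> nat -> F) (c : nat -> F) s (n : nat) :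
  (forall d, (d <= k)%N -> ph 0%N d = (d == 0%N)%:R) ->
  (forall t, (t < n)%N -> c t != 0 /\
     forall d, (d <= k)%N -> ph t.+1 d = shift (~~ (odd t (+) s)) (c t) (ph t) d) ->
  (n - s <= k)%N ->
  ph n (n - s)%N != 0 /\ forall d, (n - s < d <= k)%N -> ph n d = 0.
Proof.
move=> h0; elim: n => [|n IH] step nk.
  rewrite sub0n h0 // oner_eq0; split => // d /andP[d0 dk].
  by rewrite h0 // gtn_eqF.
have [c0 hs] := step n (ltnSn n).
have {IH} [|top zero] := IH (fun t tn => step t (ltnW tn)); first by apply: leq_trans nk; rewrite leq_sub2r.
case: (leqP s n) => [sn|]; last first.
  move=> ns; have es : s = true by move: ns; case: (s).
  have n0 : n = 0%N by move: ns; rewrite es; case: (n).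
  move: hs top zero; rewrite n0 es (_ : (0 - true = 0)%N) // (_ : (1 - true = 0)%N) //= => hs top zero.
  split; first by rewrite hs // /shift /= addr0.
  move=> [|d] /andP[d0 dk] //; rewrite hs // shiftS zero ?dk // add0r.
  case: d d0 dk => [|d] d0 dk; first by [].
  by case: ifP => // _; rewrite (zero d.+1) ?mulr0 //= ltnW.
rewrite subSn // in nk *; set m := (n - s)%N in top zero nk *.
have om : odd m = odd n (+) s by rewrite /m oddB //; case: (s).
have up : ~~ odd m == ~~ (odd n (+) s) by rewrite om.
split; first by rewrite hs // shiftS up zero ?add0r ?mulf_neq0 // ltnSn nk.
move=> [|d] /andP[md dk] //; rewrite hs // shiftS zero ?add0r; last by rewrite dk ltnW.
by case: ifP => // _; rewrite zero ?mulr0 // -ltnS md ltnW.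
Qed.

End Shift.

Lemma commutator_expand (R : nzRingType) (x y : R) :
  (1 + x) * (1 + y) * (1 - x) * (1 - y) =
  1 + (x * y + x * y - (x + y + x * y) * (x + y - x * y)).
Proof.
rewrite -mulrA.
have -> : (1 + x) * (1 + y) = 1 + (x + y + x * y).
  by rewrite mulrDl mul1r mulrDr mulr1 -!addrA; congr (_ + _); rewrite addrCA.
have -> : (1 - x) * (1 - y) = 1 - (x + y - x * y).
  rewrite mulrBl mul1r mulrBr mulr1 -addrA; congr (_ + _).
  by rewrite !opprB addrC -addrA opprD.
set w := x * y; set u := x + y + w; set v := x + y - w.
have -> : w + w = u - v by rewrite /u /v opprB [RHS]addrC addrA subrK.
by rewrite mulrDl mul1r mulrBr mulr1 -addrA; congr (_ + _); rewrite addrA (addrC u).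
Qed.

Section Commutator.

Variables (F : fieldType) (n : nat).
Implicit Types (M N : 'M[F]_n.+1) (e : bool) (c : F).

(** Row vectors of coefficients multiplied by such a matrix gain degree [r]. *)
Definition raises (r : nat) M : Prop := forall i j : 'I_n.+1, (j < i + r)%N -> M i j = 0.

Lemma raisesD r M N : raises r M -> raises r N -> raises r (M + N).
Proof. by move=> hM hN i j h; rewrite mxE hM // hN // addr0. Qed.

Lemma raisesN r M : raises r M -> raises r (- M).
Proof. by move=> hM i j h; rewrite mxE hM // oppr0. Qed.

Lemma raisesM r r' M N : raises r M -> raises r' N -> raises (r + r') (M * N).
Proof.
move=> hM hN i j h; rewrite mxE big1 // => l _.
case: (ltnP l (i + r)) => [/hM -> | le]; first by rewrite mul0r.
by rewrite [N l j]hN ?mulr0 // (leq_trans h) // addnA leq_add2r.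
Qed.

Lemma raisesX r M p : raises r M -> raises (p * r) (M ^+ p).
Proof.
move=> hM; elim: p => [|p IH].
  by rewrite expr0 mul0n => i j; rewrite addn0 => h; rewrite mxE -val_eqE /= gtn_eqF.
by rewrite exprS mulSn; apply: raisesM.
Qed.

Definition shift_mx e : 'M[F]_n.+1 :=
  \matrix_(i, j) ((j == i.+1 :> nat) && (odd j == e))%:R.
Definition step_mx e c : 'M[F]_n.+1 := 1 + c *: shift_mx e.

Lemma raises_step c e : raises 1 (c *: shift_mx e).
Proof.
move=> i j; rewrite addn1 => h; rewrite !mxE.
by rewrite (ltn_eqF h) mulr0.
Qed.

(** The commutator is the identity up to terms raising degrees by two, so its
    [p]-th power raises degrees by [2 * p] in characteristic [p]. *)
Lemma commutator_order (p : nat) e c c' : p \in [pchar F] -> (n < 2 * p)%N ->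
  (step_mx e c * step_mx (~~ e) c' * step_mx e (- c) * step_mx (~~ e) (- c')) ^+ p = 1.
Proof.
move=> ch np; rewrite /step_mx !scaleNr commutator_expand.
set x := c *: shift_mx e; set y := c' *: shift_mx (~~ e); set N := (X in 1 + X).
have rx : raises 1 x by apply: raises_step.
have ry : raises 1 y by apply: raises_step.
have rxy : raises 2 (x * y) := raisesM rx ry.
have weaken M : raises 2 M -> raises 1 M.
  by move=> h i j ij; apply: h; rewrite (ltn_trans ij) // ltn_add2l.
have rN : raises 2 N.
  apply: raisesD; first exact: raisesD.
  apply/raisesN/(@raisesM 1 1); apply: raisesD; try exact: raisesD.
    exact: weaken.
  exact/raisesN/weaken.
have chM : p \in [pchar 'M[F]_n.+1] by rewrite pchar_lalg.
rewrite -(pFrobenius_autE chM) pFrobenius_autD_comm; last exact: commr_sym (commr1 N).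
rewrite pFrobenius_aut1 pFrobenius_autE.
suff -> : N ^+ p = 0 by rewrite addr0.
apply/matrixP => i j; rewrite (raisesX (p := p) rN) ?mxE //.
by apply: leq_trans (ltn_ord j) _; apply: leq_trans np _; rewrite mulnC leq_addl.
Qed.

Lemma row_step (f : nat -> F) e c :
  (\row_(d < n.+1) f d) *m step_mx e c = \row_(d < n.+1) shift e c f d.
Proof.
rewrite /step_mx mulmxDr mulmx1 -scalemxAr; apply/rowP => d; rewrite !mxE.
rewrite /shift; congr (_ + _); case: (boolP (_ && _)) => [/andP[d0 od]|].
  have dn : (d.-1 < n.+1)%N by apply: leq_ltn_trans (leq_pred d) (ltn_ord d).
  rewrite (bigD1 (Ordinal dn)) //= big1 ?addr0.
    by rewrite !mxE /= prednK // eqxx od mulr1.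
  move=> i ni; rewrite !mxE (_ : (_ == _) = false) ?mulr0 //.
  apply: contraNF ni => /eqP e1; apply/eqP/val_inj => /=.
  by rewrite e1.
move=> h; rewrite big1 ?mulr0 // => i _; rewrite !mxE (_ : _ && _ = false) ?mulr0 //.
by apply: contraNF h => /andP[/eqP -> ->].
Qed.

End Commutator.

Lemma card_product_family (n : nat) (C : finType) (A : 'I_n -> {set C}) :
  #|[set x : {ffun 'I_n -> C} | [forall i, x i \in A i]]| = (\prod_(i < n) #|A i|)%N.
Proof.
transitivity #|(family (fun i => mem (A i)) : simpl_pred {ffun 'I_n -> C})|.
  by apply: eq_card => x; rewrite inE; apply/forallP/familyP.
by rewrite card_family foldrE big_image.
Qed.

Section ConcreteHost.

Variables (F : finFieldType) (k : nat).
Hypothesis k_ge3 : (3 <= k)%N.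

(** A matrix of determinant 1 with constant term 1, truncated in degree [k]: the
    coefficients of degrees [1] to [k] of the first row and the odd ones of the
    second row. *)
Definition edge : Type := ({ffun 'I_k -> F} * {ffun 'I_(k./2) -> F})%type.
Implicit Types (g h : edge) (s e : bool) (c : F) (d : nat).

Definition entry (n : nat) (x : {ffun 'I_n -> F}) (j : nat) : F := oapp x 0 (insub j).

Lemma entryE n (x : {ffun 'I_n -> F}) (i : 'I_n) : entry x i = x i.
Proof. by rewrite /entry valK. Qed.

Lemma entry_ffun n (f : nat -> F) j : (j < n)%N -> entry [ffun i : 'I_n => f i] j = f j.
Proof. by move=> jn; rewrite (entryE _ (Ordinal jn)) ffunE. Qed.

Definition rowU g d : F := if d is d'.+1 then entry g.1 d' else 1.

(** The even coefficients of the second row are determined by the others, as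
    the determinant is 1. *)
Definition nextV g (v : seq F) (d : nat) : F :=
  if d == 0%N then 1 else if odd d then entry g.2 d./2
  else - \sum_(i < d) (-1) ^+ i * (v`_i * rowU g (d - i)%N).
Fixpoint listV g (n : nat) : seq F :=
  if n is n'.+1 then rcons (listV g n') (nextV g (listV g n') n') else [::].
Definition rowV g d : F := (listV g d.+1)`_d.

Lemma size_listV g n : size (listV g n) = n.
Proof. by elim: n => //= n IH; rewrite size_rcons IH. Qed.

Lemma nth_listV g n d : (d < n)%N -> (listV g n)`_d = rowV g d.
Proof.
elim: n => // n IH; rewrite ltnS leq_eqVlt => /orP[/eqP -> //|dn].
by rewrite /= nth_rcons size_listV dn IH.
Qed.

Lemma rowVE g d : rowV g d = if d == 0%N then 1 else if odd d then entry g.2 d./2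
  else - \sum_(i < d) (-1) ^+ i * (rowV g i * rowU g (d - i)%N).
Proof.
rewrite /rowV /= nth_rcons size_listV ltnn eqxx /nextV.
case: ifP => // _; case: ifP => // _; congr (- _); apply: eq_bigr => i _.
by rewrite nth_listV.
Qed.

Lemma rowV0 g : rowV g 0 = 1. Proof. by []. Qed.

Lemma det1 g d : ~~ odd d -> (0 < d)%N -> detc (rowU g) (rowV g) d = 0.
Proof.
move=> ed d0; rewrite /detc big_ord_recr /= subnn mulr1 [rowV g d]rowVE.
by rewrite (gtn_eqF d0) (negPf ed) -signr_odd (negPf ed) mul1r addrN.
Qed.

Lemma rowV_unique g (f : nat -> F) n :
  f 0%N = 1 -> (forall d, odd d -> (d <= n)%N -> f d = entry g.2 d./2) ->
  (forall d, ~~ odd d -> (0 < d <= n)%N -> detc (rowU g) f d = 0) ->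
  forall d, (d <= n)%N -> rowV g d = f d.
Proof.
move=> f0 fo fd; elim/ltn_ind => d IH dn.
rewrite rowVE; case: eqP => [->|/eqP d0]; first by rewrite f0.
case: (boolP (odd d)) => od; first by rewrite fo.
have := fd d od; rewrite lt0n d0 dn => /(_ isT).
rewrite /detc big_ord_recr /= subnn mulr1 -signr_odd (negPf od) mul1r => /eqP.
rewrite addrC addr_eq0 => /eqP ->; congr (- _); apply: eq_bigr => i _.
by rewrite IH // (leq_trans (ltnW (ltn_ord i))).
Qed.

(** [move false] and [move true] multiply by elementary upper and lower
    triangular matrices. *)
Definition move s c g : edge :=
  ([ffun i : 'I_k => shift (~~ s) c (rowU g) i.+1],
   [ffun j : 'I_(k./2) => shift s c (rowV g) j.*2.+1]).

Lemma rowU_move s c g d : (d <= k)%N -> rowU (move s c g) d = shift (~~ s) c (rowU g) d.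
Proof.
case: d => [|d] dk; first by rewrite /shift /= addr0.
by rewrite /= (entry_ffun (fun i => shift (~~ s) c (rowU g) i.+1)).
Qed.

Lemma rowV_move s c g d : (d <= (k./2).*2)%N -> rowV (move s c g) d = shift s c (rowV g) d.
Proof.
have k2k : ((k./2).*2 <= k)%N by rewrite -{2}(odd_double_half k) leq_addl.
apply: rowV_unique => [|e oe le|e ee /andP[e0 le]].
- by rewrite /shift /= addr0.
- have lt : (e./2 < k./2)%N by have := odd_double_half e; rewrite oe; lia.
  rewrite (entry_ffun (fun j => shift s c (rowV g) j.*2.+1)) //.
  by rewrite -[in LHS](odd_double_half e) oe.
rewrite -[RHS](det1 g ee e0) -(detc_shift (rowU g) (rowV g) s c ee); apply: eq_bigr => i _.
by rewrite rowU_move // (leq_trans (leq_subr _ _)) // (leq_trans le).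
Qed.

Lemma edge_ext g h : (forall d, (d <= k)%N -> rowU g d = rowU h d) ->
  (forall d, (d <= (k./2).*2)%N -> rowV g d = rowV h d) -> g = h.
Proof.
case: g h => [g1 g2] [h1 h2] eU eV; congr (_, _); apply/ffunP => i.
  by have := eU i.+1 (ltn_ord i); rewrite /= !entryE.
have := eV i.*2.+1; rewrite ltn_double ltn_ord => /(_ isT).
by rewrite !rowVE /= odd_double /= uphalf_double !entryE.
Qed.

Lemma moveD s a b g : move s a (move s b g) = move s (a + b) g.
Proof.
apply: edge_ext => d dk.
  by rewrite !rowU_move //; apply: (shiftD (n := k)) dk => ? ?; rewrite rowU_move.
by rewrite !rowV_move //; apply: (shiftD (n := (k./2).*2)) dk => ? ?; rewrite rowV_move.
Qed.

Lemma move0 s g : move s 0 g = g.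
Proof. by apply: edge_ext => d dk; rewrite ?rowU_move ?rowV_move // shift0. Qed.

Lemma half_ge1 : (1 <= (k./2).*2)%N.
Proof. by case: k k_ge3 => [|[|[|]]]. Qed.

Let alpha g := rowU g 1.
Let beta g := rowV g 1.

Lemma alphaX a g : alpha (move false a g) = alpha g + a.
Proof. by rewrite /alpha rowU_move /shift /= ?mulr1 // ltnW // ltnW. Qed.

Lemma alphaY a g : alpha (move true a g) = alpha g.
Proof. by rewrite /alpha rowU_move /shift /= ?addr0 // ltnW // ltnW. Qed.

Lemma betaX a g : beta (move false a g) = beta g.
Proof. by rewrite /beta rowV_move /shift /= ?addr0 // half_ge1. Qed.

Lemma betaY a g : beta (move true a g) = beta g + a.
Proof. by rewrite /beta rowV_move ?half_ge1 // /shift /= rowV0 mulr1. Qed.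

(** A closed reduced word is cut into two halves of length at most [k]: read
    from the base point in the two directions they lead to the same edge, but
    they have different top degrees. *)
Lemma no_closed_word (h : nat -> edge) s (r : nat) : (0 < r <= 2 * k)%N ->
  (forall t, (t < r)%N -> exists2 c, c != 0 & h t.+1 = move (odd t (+) s) c (h t)) ->
  h r <> h 0%N.
Proof.
move=> /andP[r0 rk] step er.
have [c hc] : exists c : nat -> F, forall t, (t < r)%N ->
    c t != 0 /\ h t.+1 = move (odd t (+) s) (c t) (h t).
  pose P t a := (a != 0) && (h t.+1 == move (odd t (+) s) a (h t)).
  exists (fun t => odflt 0 [pick a | P t a]) => t /step[a a0 ea].
  case: pickP => [b /andP[b0 /eqP //]|/(_ a)].
  by rewrite /P a0 ea eqxx.
pose ph (w : edge) := phi (rowU (h 0%N)) (rowV (h 0%N)) (rowU w) (rowV w).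
have ph0 d : (d <= k)%N -> ph (h 0%N) d = (d == 0%N)%:R.
  move=> _; rewrite /ph; case: (boolP (odd d)) => od.
    by rewrite phi_odd //; case: d od.
  rewrite phi_even //; case: d od => [|d] od; last by rewrite det1.
  by rewrite /detc big_ord_recl big_ord0 /= mul1r mulr1 addr0 rowV0.
have phm u a w d : (d <= k)%N -> ph (move u a w) d = shift (~~ u) a (ph w) d.
  move=> dk; rewrite /ph -phi_shift; apply: eq_bigr => i _; rewrite /phi_term.
  have id := leq_subr i d.
  case: ifP => oi; last by rewrite rowU_move // (leq_trans id).
  rewrite rowV_move //.
  have i0 : (0 < i)%N by case: (nat_of_ord i) oi.
  have: (k <= (k./2).*2.+1)%N by rewrite -{1}(odd_double_half k); case: (odd k).
  lia.
pose s' := odd r.-1 (+) s.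
pose m := uphalf r; pose m' := r./2.
have em : (m + m' = r)%N by rewrite /m /m' uphalf_half -addnA addnn odd_double_half.
have fwd n : (n <= r)%N -> (n - s <= k)%N ->
    ph (h n) (n - s)%N != 0 /\ forall d, (n - s < d <= k)%N -> ph (h n) d = 0.
  move=> nr; apply: (alternating_top (ph := fun t => ph (h t)) (c := c)) => // t tn.
  have [c0 et] := hc t (leq_trans tn nr); split => // d dk.
  by rewrite et phm.
have bwd n : (n <= r)%N -> (n - s' <= k)%N ->
    ph (h (r - n)%N) (n - s')%N != 0 /\ forall d, (n - s' < d <= k)%N -> ph (h (r - n)%N) d = 0.
  move=> nr; apply: (alternating_top (ph := fun t => ph (h (r - t)%N)) (c := fun t => - c (r - t.+1)%N)).
    by move=> d dk; rewrite subn0 er ph0.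
  move=> t tn; have tr : (t < r)%N by apply: leq_trans tn nr.
  have [c0 et] := hc (r - t.+1)%N (rev_ord_proof (Ordinal tr)).
  rewrite oppr_eq0; split => // d dk; rewrite -phm //; congr (ph _ d).
  have -> : (r - t = (r - t.+1).+1)%N by rewrite subnS prednK // subn_gt0.
  rewrite et; have -> : odd t (+) s' = odd (r - t.+1) (+) s.
    rewrite /s' addbA -oddD; congr (_ (+) _).
    have -> : (t + r.-1 = r - t.+1 + t.*2)%N by lia.
    by rewrite oddD odd_double addbF.
  by rewrite moveD addNr move0.
have mk : (m <= k)%N by rewrite /m; lia.
have m'k : (m' <= k)%N by rewrite /m'; lia.
have [f1 f2] := fwd m (leq_trans (leq_addr m' m) (eq_leq em)) (leq_trans (leq_subr _ _) mk).
have [b1 b2] := bwd m' (leq_trans (leq_addl m m') (eq_leq em)) (leq_trans (leq_subr _ _) m'k).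
have rm : (r - m' = m)%N by rewrite -em addnK.
rewrite rm in b1 b2.
case: (ltngtP (m - s) (m' - s')) => [lt|lt|eq].
- by move: b1; rewrite f2 ?eqxx // lt (leq_trans (leq_subr _ _) m'k).
- by move: f1; rewrite b2 ?eqxx // lt (leq_trans (leq_subr _ _) mk).
have [r1 es] : r = 1%N /\ s = true.
  move: eq; rewrite /m /m' /s' uphalf_half.
  have := odd_double_half r; case: (r) r0 => // r' _ /=.
  by case: (odd r'); case: (s) => /=; lia.
have [c0 e1] := hc 0%N r0; move: er; rewrite r1 e1 es /= => /(congr1 beta).
by rewrite betaY => /eqP; rewrite -subr_eq0 addrAC subrr add0r (negPf c0).
Qed.

Lemma host_no_relation (h : nat -> edge) s (r : nat) : (0 < r <= 2 * k)%N ->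
  (forall t, (t < r)%N -> exists2 c : F, c != 0 &
     h t.+1 = (if odd t (+) s then move true else move false) c (h t)) ->
  h r <> h 0%N.
Proof.
move=> r2k step; apply: (no_closed_word (s := s)) => // t /step[c c0 ->].
by exists c => //; case: (_ (+) _).
Qed.

End ConcreteHost.

Section Pieces.

Variables (F : finFieldType) (k : nat).
Hypothesis k_ge3 : (3 <= k)%N.
Let T := edge F k.
Let alpha (g : T) : F := rowU g 1.
Let beta (g : T) : F := rowV g 1.
Let X : F -> T -> T := @move F k false.
Let Y : F -> T -> T := @move F k true.
Let Q := #|F|.

Lemma card_box (A : nat -> {set F}) :
  #|[set g : T | [forall i : 'I_k, g.1 i \in A i] && (beta g == 0)]| =
  (\prod_(i < k) #|A i| * Q ^ (k./2).-1)%N.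
Proof.
have h0 : (0 < k./2)%N by case: k k_ge3 => [|[|[|]]].
pose B (j : 'I_(k./2)) : {set F} := if j == 0%N :> nat then [set 0] else setT.
have -> : (Q ^ (k./2).-1 = \prod_j #|B j|)%N.
  case: (k./2) h0 @B => // n _ B; rewrite big_ord_recl /= /B cards1 mul1n.
  by rewrite (eq_bigr (fun=> Q)) ?prod_nat_const ?card_ord // => i _; rewrite cardsT.
rewrite -!card_product_family -cardsX; apply: eq_card => g; rewrite !inE.
congr (_ && _); rewrite /beta rowVE /= (entryE g.2 (Ordinal h0)).
apply/eqP/forallP => [e j | /(_ (Ordinal h0))]; last by rewrite /B /= inE => /eqP.
rewrite /B; case: eqP => j0; last by rewrite inE.
by rewrite inE (_ : j = Ordinal h0) ?e //; apply: val_inj.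
Qed.

Lemma degree_eq_add3 : exists n, k = n.+3.
Proof. by case: k k_ge3 => [|[|[|n]]] // _; exists n. Qed.

Lemma card_corners :
  #|[set g : T | (alpha g == 0) && (beta g == 0)]| = (Q ^ (k.-1 + (k./2).-1))%N.
Proof.
have [n kn] := degree_eq_add3.
pose A i : {set F} := if i == 0%N then [set 0] else setT.
rewrite expnD -[(Q ^ k.-1)%N](_ : (\prod_(i < k) #|A i|)%N = _).
  rewrite -card_box; apply: eq_card => g; rewrite !inE; congr (_ && _).
  have k0 : (0 < k)%N by rewrite kn.
  rewrite /alpha /= (entryE g.1 (Ordinal k0)).
  apply/eqP/forallP => [e i | /(_ (Ordinal k0))]; last by rewrite /A /= inE => /eqP.
  rewrite /A; case: eqP => i0; last by rewrite inE.
  by rewrite inE (_ : i = Ordinal k0) ?e //; apply: val_inj.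
rewrite kn big_ord_recl /= /A cards1 mul1n.
by rewrite (eq_bigr (fun=> Q)) ?prod_nat_const ?card_ord // => i _; rewrite cardsT.
Qed.

Lemma card_slices (C : {set F}) :
  #|[set g : T | corner alpha beta g && (rowU g 2 + 1 \in C)]| =
  (#|C| * Q ^ (k.-2 + (k./2).-1))%N.
Proof.
have [n kn] := degree_eq_add3.
pose A i : {set F} := if i == 0%N then [set 0] else if i == 1%N then [set x | x + 1 \in C] else setT.
have cA1 : #|A 1%N| = #|C|.
  rewrite -(card_imset C (addIr (-1))); apply: eq_card => x; rewrite inE.
  apply/idP/imsetP => [xC|[y yC ->]]; last by rewrite subrK.
  by exists (x + 1); rewrite ?addrK.
rewrite expnD mulnA -[(_ * Q ^ k.-2)%N](_ : (\prod_(i < k) #|A i|)%N = _).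
  rewrite -card_box; apply: eq_card => g; rewrite !inE /corner andbAC; congr (_ && _).
  have k0 : (0 < k)%N by rewrite kn.
  have k1 : (1 < k)%N by rewrite kn.
  rewrite /alpha /= (entryE g.1 (Ordinal k0)) (entryE g.1 (Ordinal k1)).
  apply/andP/forallP => [[/eqP e0 e1] i | h].
    rewrite /A; case: eqP => i0; last case: eqP => i1; last by rewrite inE.
      by rewrite inE (_ : i = Ordinal k0) ?e0 //; apply: val_inj.
    by rewrite inE (_ : i = Ordinal k1) //; apply: val_inj.
  by have := h (Ordinal k0); have := h (Ordinal k1); rewrite /A /= !inE.
have cA0 : #|A 0%N| = 1%N by rewrite cards1.
have cA2 i : #|A i.+2| = Q by rewrite cardsT.
rewrite kn big_ord_recl big_ord_recl /= cA0 cA1 mul1n; congr (_ * _)%N.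
by rewrite (eq_bigr (fun=> Q)) ?prod_nat_const ?card_ord // => i _; apply: cA2.
Qed.

Lemma card_flexible :
  #|[set g : T | [&& corner alpha beta g, (rowU g 2 == 0)%R & (rowU g 3 == 0)%R]]| =
  (Q ^ (k - 3 + (k./2).-1))%N.
Proof.
have [n kn] := degree_eq_add3.
pose A i : {set F} := if (i < 3)%N then [set 0] else setT.
rewrite expnD -[(Q ^ (k - 3))%N](_ : (\prod_(i < k) #|A i|)%N = _).
  rewrite -card_box; apply: eq_card => g; rewrite !inE /corner -andbA andbCA andbC.
  congr (_ && _).
  have k0 : (0 < k)%N by rewrite kn.
  have k1 : (1 < k)%N by rewrite kn.
  have k2 : (2 < k)%N by rewrite kn.
  rewrite /alpha /= (entryE g.1 (Ordinal k0)) (entryE g.1 (Ordinal k1)) (entryE g.1 (Ordinal k2)).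
  apply/and3P/forallP => [[e0 e1 e2] i | h].
    rewrite /A; case: ltnP => i3; last by rewrite inE.
    rewrite inE; case: i i3 => -[|[|[|//]]] ik /= _.
    - by rewrite (_ : Ordinal ik = Ordinal k0) //; apply: val_inj.
    - by rewrite (_ : Ordinal ik = Ordinal k1) //; apply: val_inj.
    - by rewrite (_ : Ordinal ik = Ordinal k2) //; apply: val_inj.
  by have := h (Ordinal k0); have := h (Ordinal k1); have := h (Ordinal k2); rewrite /A /= !inE.
have cA0 i : (i < 3)%N -> #|A i| = 1%N by rewrite /A => ->; rewrite cards1.
have cA3 i : #|A i.+3| = Q by rewrite cardsT.
rewrite kn big_ord_recl big_ord_recl big_ord_recl /= !cA0 // !mul1n -addn3 addnK.
by rewrite (eq_bigr (fun=> Q)) ?prod_nat_const ?card_ord // => i _; apply: cA3.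
Qed.

Lemma rowU_turn (a : F) (g : T) : a != 0 -> corner alpha beta g ->
  rowU (turn X Y a g) 2 = rowU g 2 - 1 /\ rowU (turn X Y a g) 3 = rowU g 3 + a.
Proof.
move=> a0 /andP[/eqP a1 _].
have X1 c h : rowU (X c h) 1 = rowU h 1 + c.
  by rewrite /X rowU_move ?(ltnW (ltnW k_ge3)) // /shift /= mulr1.
have X2 c h : rowU (X c h) 2 = rowU h 2 by rewrite /X rowU_move ?(ltnW k_ge3) // /shift /= addr0.
have X3 c h : rowU (X c h) 3 = rowU h 3 + c * rowU h 2 by rewrite /X rowU_move.
have Y1 c h : rowU (Y c h) 1 = rowU h 1.
  by rewrite /Y rowU_move ?(ltnW (ltnW k_ge3)) // /shift /= addr0.
have Y2 c h : rowU (Y c h) 2 = rowU h 2 + c * rowU h 1 by rewrite /Y rowU_move ?(ltnW k_ge3).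
have Y3 c h : rowU (Y c h) 3 = rowU h 3 by rewrite /Y rowU_move // /shift /= addr0.
have {}a1 : rowU g 1 = 0 by exact: a1.
rewrite /turn; split; first by rewrite X2 Y2 X2 X1 Y2 Y1 a1; field.
by rewrite X3 Y3 Y2 X3 X2 X1 Y3 Y2 Y1 a1; field.
Qed.

(** [turn a] is a commutator of two elementary matrices, acting on truncated
    rows. *)
Lemma turn_order (p : nat) (a : F) (g : T) : p \in [pchar F] -> (k < 2 * p)%N ->
  iter p (turn X Y a) g = g.
Proof.
move=> ch kp.
have k2k : ((k./2).*2 <= k)%N by rewrite -{2}(odd_double_half k) leq_addl.
pose RU (h : T) : 'rV[F]_k.+1 := \row_(d < k.+1) rowU h d.
pose RV (h : T) : 'rV[F]_((k./2).*2.+1) := \row_(d < (k./2).*2.+1) rowV h d.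
have RUm s c h : RU (move s c h) = RU h *m step_mx k (~~ s) c.
  by rewrite row_step; apply/rowP => d; rewrite !mxE rowU_move // -ltnS.
have RVm s c h : RV (move s c h) = RV h *m step_mx (k./2).*2 s c.
  by rewrite row_step; apply/rowP => d; rewrite !mxE rowV_move // -ltnS.
pose MU := step_mx k false a^-1 * step_mx k (~~ false) a * step_mx k false (- a^-1) *
  step_mx k (~~ false) (- a).
pose MV := step_mx (k./2).*2 true a^-1 * step_mx (k./2).*2 (~~ true) a *
  step_mx (k./2).*2 true (- a^-1) * step_mx (k./2).*2 (~~ true) (- a).
have itU n : RU (iter n (turn X Y a) g) = RU g *m (MU ^+ n).
  elim: n => [|n IH]; first by rewrite mulmx1.
  by rewrite iterS /turn !RUm IH exprSr /MU -!mulmxE !mulmxA.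
have itV n : RV (iter n (turn X Y a) g) = RV g *m (MV ^+ n).
  elim: n => [|n IH]; first by rewrite mulmx1.
  by rewrite iterS /turn !RVm IH exprSr /MV -!mulmxE !mulmxA.
have eU : RU (iter p (turn X Y a) g) = RU g.
  by rewrite itU (commutator_order _ _ _ ch) ?mulmx1.
have eV : RV (iter p (turn X Y a) g) = RV g.
  by rewrite itV (commutator_order _ _ _ ch) ?mulmx1 // (leq_ltn_trans k2k).
apply: edge_ext => // d; rewrite -ltnS => dk.
  by move/rowP/(_ (Ordinal dk)): eU; rewrite !mxE.
by move/rowP/(_ (Ordinal dk)): eV; rewrite !mxE.
Qed.

Let e := (k.-1 + (k./2).-1)%N.

Lemma piece_fixed : (k <= Q)%N -> block k (k * Q ^ e).
Proof.
move=> kQ; rewrite -card_corners.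
apply: (block_fixed (X := X) (Y := Y) (alpha := alpha) (beta := beta)) => //.
all: try by [move=> *; apply: moveD | move=> *; apply: move0 | move=> *; apply: alphaX
  | move=> *; apply: betaX | move=> *; apply: alphaY | move=> *; apply: betaY].
- exact: ltnW (ltnW k_ge3).
- exact: host_no_relation.
Qed.

Lemma piece_slices (c : nat) : (k < Q)%N -> (c <= Q)%N ->
  block k (k.+1 * Q ^ e - c * Q ^ e.-1).
Proof.
move=> kQ /subset_of_field[C <-].
have -> : e.-1 = (k.-2 + (k./2).-1)%N by rewrite /e; have [n ->] := degree_eq_add3.
rewrite -card_corners -card_slices.
apply: (@block_slices F T X Y alpha beta _ _ _ _ _ _ _ _ k _ _ (fun g => rowU g 2)) => //.
all: try by [move=> *; apply: moveD | move=> *; apply: move0 | move=> *; apply: alphaX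
  | move=> *; apply: betaX | move=> *; apply: alphaY | move=> *; apply: betaY].
- exact: ltnW (ltnW k_ge3).
- exact: host_no_relation.
- by move=> a g a0 cg; case: (rowU_turn a0 cg).
Qed.

Lemma piece_flexible (p y : nat) : p \in [pchar F] -> (k < 2 * p)%N -> (k < Q)%N ->
  (y <= Q ^ (e - 2))%N -> block k (k.+1 * Q ^ e - y).
Proof.
move=> ch kp kQ.
have -> : (e - 2 = k - 3 + (k./2).-1)%N by rewrite /e; have [n ->] := degree_eq_add3; rewrite /=; lia.
rewrite -card_corners -card_flexible => hy.
apply: (@block_flexible F T X Y alpha beta _ _ _ _ _ _ _ _ k _ _
   (fun g => rowU g 2) (fun g => rowU g 3) _ _ p) => //.
all: try by [move=> *; apply: moveD | move=> *; apply: move0 | move=> *; apply: alphaX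
  | move=> *; apply: betaX | move=> *; apply: alphaY | move=> *; apply: betaY].
- exact: ltnW (ltnW k_ge3).
- exact: host_no_relation.
- by move=> a g a0 cg; case: (rowU_turn a0 cg).
- by move=> a g a0 cg; case: (rowU_turn a0 cg).
- by move=> a g _ _; apply: turn_order.
Qed.

End Pieces.

Local Open Scope nat_scope.

(** * Sums of blocks over prime fields *)

Definition host_exp (k : nat) : nat := k.-1 + k./2.-1.

Section PrimeFields.

Variables (k p : nat).
Hypotheses (k_ge3 : 3 <= k) (p_pr : prime p).

Lemma block_prime_fixed : k <= p -> block k (k * p ^ host_exp k).
Proof.
by move=> kp; have := @piece_fixed 'F_p k k_ge3; rewrite card_Fp //; apply.
Qed.

Lemma block_prime_slices c : k < p -> c <= p ->
  block k (k.+1 * p ^ host_exp k - c * p ^ (host_exp k).-1).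
Proof.
by move=> kp cp; have := @piece_slices 'F_p k k_ge3 c; rewrite card_Fp //; apply.
Qed.

Lemma block_prime_flexible y : k < p -> y <= p ^ (host_exp k - 2) ->
  block k (k.+1 * p ^ host_exp k - y).
Proof.
move=> kp yp; have := @piece_flexible 'F_p k k_ge3 p y; rewrite card_Fp //; apply => //.
  exact: pchar_Fp.
by rewrite mul2n -addnn ltn_addl.
Qed.

Lemma host_exp_ge2 : 2 <= host_exp k.
Proof. by rewrite /host_exp; lia. Qed.

Lemma block_prime_many_flexible a y : k < p -> y <= a * p ^ (host_exp k - 2) ->
  block k (a * (k.+1 * p ^ host_exp k) - y).
Proof.
move=> kp; have p0 := prime_gt0 p_pr.
have lt : p ^ (host_exp k - 2) <= k.+1 * p ^ host_exp k.
  by rewrite (leq_trans (leq_pexp2l p0 (leq_subr 2 _))) // leq_pmull.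
elim: a y => [|a IH] y; first by rewrite mul0n leqn0 => /eqP ->; exact: block0.
set y1 := minn y (p ^ (host_exp k - 2)) => ya.
have y1y : y1 <= y by exact: geq_minl.
have b1 := @block_prime_flexible y1 kp (geq_minr _ _).
have ya1 : y - y1 <= a * p ^ (host_exp k - 2).
  by move: ya; rewrite /y1 mulSn; move: (p ^ _) (a * _) => u v; lia.
have := blockD b1 (IH _ ya1); congr (block _ _).
have : a * p ^ (host_exp k - 2) <= a * (k.+1 * p ^ host_exp k) by rewrite leq_mul2l lt orbT.
have : y1 <= p ^ (host_exp k - 2) by exact: geq_minr.
rewrite (mulSn a); clear b1; move: y1y ya1 lt; rewrite -/y1; move: y1 (p ^ (_ - 2)) (k.+1 * _) => c u v.
by move: (a * u) (a * v) => au av; lia.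
Qed.

(** Flexible pieces have [k.+1] units of size [p ^ host_exp k] and fixed ones
    have [k], so every large multiple of the unit is a sum of both; once there
    are [p ^ 2] flexible pieces, a whole unit can be cut from them. *)
Lemma block_of_prime n : k < p ->
  (p ^ 2 * k.+1 + k ^ 2) * p ^ host_exp k <= n -> block k n.
Proof.
move=> kp; have p0 := prime_gt0 p_pr; set L := p ^ host_exp k => hn.
have L0 : 0 < L by rewrite expn_gt0 p0.
have LE : L = p ^ 2 * p ^ (host_exp k - 2) by rewrite -expnD subnKC // host_exp_ge2.
pose u := (n + L.-1) %/ L; pose y := u * L - n.
have [nu yL] : n <= u * L /\ y < L.
  have := divn_eq (n + L.-1) L; rewrite /y -/u; have := ltn_pmod (n + L.-1) L0.
  move: (_ %% _) => z; move: (u * L) => w; lia.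
have uge : p ^ 2 * k.+1 + k ^ 2 <= u by rewrite -(leq_pmul2r L0) (leq_trans hn).
pose b := (k * u) %% k.+1; pose a := (u - b * k) %/ k.+1.
have bk : b <= k by rewrite -ltnS ltn_pmod.
have bkk : b * k <= k ^ 2 by rewrite expnS expn1 leq_mul2r bk orbT.
have ua : u = a * k.+1 + b * k.
  have bku : b * k <= u by rewrite (leq_trans bkk) // (leq_trans _ uge) // leq_addl.
  suff /divnK : k.+1 %| u - b * k by rewrite -/a => ->; rewrite subnK.
  have : u = b * k %[mod k.+1].
    rewrite modnMml -mulnA mulnCA mulnC -mulnA.
    have -> : k * (k * u) = k.-1 * u * k.+1 + u by case: k k_ge3 => // j _; rewrite -pred_Sn; ring.
    by rewrite modnMDl.
  by move/eqP; rewrite eqn_mod_dvd.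
have ap : p ^ 2 <= a.
  rewrite -(leq_pmul2r (ltn0Sn k)); move: uge; rewrite {1}ua => h.
  by rewrite -(leq_add2r (k ^ 2)) (leq_trans h) // leq_add2l.
have ya : y <= a * p ^ (host_exp k - 2).
  by rewrite (leq_trans (ltnW yL)) // LE leq_mul2r ap orbT.
have := blockD (block_prime_many_flexible kp ya) (blockM b (block_prime_fixed (ltnW kp))).
congr (block _ _); rewrite -/L /y.
have yv : u * L - n <= a * (k.+1 * L).
  rewrite (leq_trans (ltnW yL)) // mulnA leq_pmull // muln_gt0 andbT (leq_trans _ ap) //.
  by rewrite expn_gt0 p0.
by rewrite addnBAC // [in a * _]mulnA [b * _]mulnA -mulnDl -ua subKn.
Qed.

End PrimeFields.

(** * A prime not far above a given number *)

(** Each of the terms [2n %/ p^i - 2 * (n %/ p^i)] of Legendre's formula is 0 or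
    1, and it is 0 when [p^i > 2n]. *)
Lemma logn_central_binomial p n : prime p ->
  logn p 'C(n.*2, n) <= trunc_log p n.*2.
Proof.
move=> pr; have p1 := prime_gt1 pr.
have Cgt0 : 0 < 'C(n.*2, n) by rewrite bin_gt0 -addnn leq_addr.
have := bin_fact (leq_addr n n : n <= n + n); rewrite addKn addnn.
move/(congr1 (logn p)); rewrite !lognM ?muln_gt0 ?fact_gt0 //.
have lf m : m <= n.*2 -> logn p m`! = \sum_(1 <= i < n.*2.+1) m %/ p ^ i.
  move=> mn; rewrite logn_fact // (@big_cat_nat _ _ _ m.+1 1 n.*2.+1) //=.
  rewrite [X in _ = _ + X]big_nat_cond [X in _ = _ + X]big1 ?addn0 // => i /andP[/andP[mi _] _].
  by rewrite divn_small // (ltn_trans (ltn_expl m p1)) // ltn_exp2l.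
rewrite !lf ?leqnn //; last by rewrite -addnn leq_addr.
rewrite -big_split /= => e; rewrite -(leq_add2r (\sum_(1 <= i < n.*2.+1) (n %/ p ^ i + n %/ p ^ i))).
rewrite e.
pose l := trunc_log p n.*2.
have lE : l = \sum_(1 <= i < n.*2.+1) (i <= l).
  rewrite big_nat_cond.
  have ll : l <= n.*2 by case: n @l {e lf Cgt0} => [|n] l; rewrite /l ?trunc_log0 //
    ltnW // (leq_trans (ltn_expl _ p1)) // trunc_logP.
  rewrite -big_nat_cond (@big_cat_nat _ _ _ l.+1) //=.
  rewrite [X in _ + X]big_nat_cond [X in _ + X]big1 => [|i /andP[/andP[li _] _]]; last by rewrite leqNgt li.
  by rewrite addn0 big_nat_cond (eq_bigr (fun=> 1)) => [|i /andP[/andP[_ li] _]];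
    rewrite -?big_nat_cond ?sum_nat_const_nat ?subSS ?subn0 ?muln1 // -ltnS li.
rewrite -/l lE -big_split /=; apply: leq_sum => i _.
have pi0 : 0 < p ^ i by rewrite expn_gt0 (ltnW p1).
case: (leqP i l) => [_|li].
  have := divn_eq n (p ^ i); have := ltn_pmod n pi0; move: (n %% _) (n %/ _) => a b la e'.
  rewrite -addnn {1}e' {1}e' addnACA -mulnDl divnMDl // addnC leq_add2r -ltnS ltn_divLR //.
  by rewrite mul2n -addnn; rewrite -addSn leq_add // ltnW.
have : n.*2 < p ^ i.
  by apply: leq_trans (trunc_log_ltn n.*2 p1) _; rewrite leq_exp2l.
by move=> lt; rewrite divn_small.
Qed.

Lemma central_binomial_ge n : 4 ^ n <= n.*2.+1 * 'C(n.*2, n).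
Proof.
elim: n => [|n IH] //.
have e1 : n.*2.+1 * 'C(n.*2, n) = n.+1 * 'C(n.*2.+1, n).
  by have := mul_bin_down n.*2.+1 n; rewrite /= => ->; congr (_ * _); lia.
have e2 : n.+1 * 'C(n.*2.+2, n.+1) = n.*2.+2 * 'C(n.*2.+1, n).
  by have := mul_bin_diag n.*2.+2 n; rewrite /= => ->.
rewrite expnS doubleS; nia.
Qed.

Lemma count_primes_le n : count prime (iota 0 n.*2) <= n.
Proof.
elim: n => [|n IH] //; rewrite doubleS -[n.*2.+2]addn2 iotaD count_cat add0n /=.
case: n IH => [|[|n]] //= IH.
have -> : prime n.+2.*2 = false.
  by apply/negP => /even_prime[//|]; rewrite odd_double.
by rewrite add0n addn0 -[n.+3]addn1 leq_add //; case: prime.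
Qed.

(** Without primes in the window, the central binomial coefficient [C(2n,n)]
    with [2n] close to [j * k] would be a product of at most [k/2 + 1] prime
    powers, each at most [2n]; this is below its known order [4 ^ n]. *)
Lemma prime_in_window j k : 4 <= j -> 12 < k -> k < 2 ^ j ->
  exists2 p, prime p & k < p <= j * k.
Proof.
move=> j4 k12 kj; pose n := (j * k)./2.
have jkn : (n.*2 <= j * k) && (j * k <= n.*2.+1) by rewrite /n; lia.
have [/andP[nj jn]] := (jkn, tt); set C := 'C(n.*2, n).
have C0 : 0 < C by rewrite bin_gt0 -addnn leq_addr.
case: (boolP (has (fun p => k < p) (primes C))) => [/hasP[p]|/hasPn small].
  rewrite mem_primes C0 /= => /andP[pr dv] kp; exists p => //; rewrite kp /=.
  have := logn_central_binomial n pr; rewrite -/C => lt.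
  have lg : 0 < logn p C by rewrite logn_gt0 mem_primes pr C0.
  have := leq_trans lg lt; rewrite trunc_log_gt0.
  by case/andP=> _ pn; apply: leq_trans nj; rewrite -(prednK (prime_gt0 pr)).
have Cle : C <= n.*2.+1 ^ (k./2.+1).
  rewrite {1}(prod_prime_decomp C0) prime_decompE big_map /=.
  apply: (@leq_trans (\prod_(p <- primes C) n.*2.+1)).
    rewrite big_seq [X in _ <= X]big_seq; apply: leq_prod => p; rewrite mem_primes => /and3P[pr _ _].
    have p1 := prime_gt1 pr.
    apply: leq_trans (leq_pexp2l (ltnW p1) (logn_central_binomial n pr)) _.
    case: (n) => [|n']; first by rewrite trunc_log0.
    by rewrite ltnW // ltnS trunc_logP.
  rewrite big_const_seq count_predT iter_muln_1 leq_pexp2l //.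
  apply: leq_trans (count_primes_le _); rewrite -size_filter; apply: uniq_leq_size (primes_uniq _) _.
  move=> p pC; rewrite mem_filter mem_iota /= add0n; have := small p pC; rewrite -leqNgt => pk.
  by move: pC; rewrite mem_primes => /and3P[-> _ _] /=; lia.
have big4 := leq_trans (central_binomial_ge n) (leq_mul (leqnn _) Cle).
have jj : j ^ 2 <= 2 ^ j.
  elim: j j4 {kj jkn nj jn C C0 small Cle big4 n} => [|j IH] // j4.
  case: (ltngtP j 3) => [|j3|->] //; first lia.
  have := IH j3; rewrite [2 ^ j.+1]expnS; nia.
have n2 : n.*2.+1 ^ 2 <= 2 ^ (3 * j).
  have -> : 2 ^ (3 * j) = 2 ^ j * (2 ^ j) ^ 2.
    by rewrite -expnM -expnD; congr (_ ^ _); lia.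
  apply: (@leq_trans ((j * 2 ^ j) ^ 2)); last by rewrite expnMn leq_mul.
  by rewrite leq_exp2r //; nia.
have : (4 ^ n) ^ 2 <= 2 ^ (3 * j * k./2.+2).
  apply: leq_trans (_ : (n.*2.+1 ^ 2) ^ k./2.+2 <= _).
    by rewrite -[X in _ <= X]expnM mulnC expnM leq_exp2r // expnS.
  by rewrite expnM leq_exp2r.
have -> : (4 ^ n) ^ 2 = 2 ^ (4 * n) by rewrite -expnM (_ : 4 = 2 ^ 2) // -expnM; congr (_ ^ _); lia.
rewrite leq_exp2l //; nia.
Qed.

(** * Blocks of the required size *)

(** The number of points of a block is [k] times this; it is the geometric sum
    behind the fraction defining [kprime]. *)
Definition block_size (k : nat) : nat := 4 * \sum_(i < k) k.-1 ^ (2 * i).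

Lemma block_size_ge k : 0 < k -> 4 * k.-1 ^ (2 * k.-1) <= block_size k.
Proof.
by case: k => // k _; rewrite /block_size leq_mul2l big_ord_recr leq_addl.
Qed.

Lemma block_size_of_prime k p : 3 <= k -> prime p -> k < p ->
  k.+2 * p ^ (host_exp k).+2 <= 4 * k.-1 ^ (2 * k.-1) -> block k (block_size k).
Proof.
move=> k3 pr kp h; apply: (block_of_prime k3 pr kp).
apply: leq_trans (leq_trans h (block_size_ge (ltnW (ltnW k3)))).
rewrite -[(host_exp k).+2]add2n expnD mulnA leq_mul2r; apply/orP; right.
rewrite -addn1 mulnC -[k.+2]addn1 [X in _ <= X]mulnDl mul1n addn1 leq_add2l.
by rewrite leq_exp2r // ltnW.
Qed.

Lemma poly_le_exp k : 24 <= k -> k.+2 ^ 2 * k.-1 ^ 4 <= 16 * 2 ^ k.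
Proof.
move=> k24; have -> : k = (k - 24 + 23).+1 by lia.
elim: (k - 24) => {k k24} [|n IH]; first by lia.
rewrite addSn [2 ^ _.+2]expnS; move: (2 ^ _) IH => P /= IH.
have hA : 9 * (n + 23).+4 ^ 2 <= 10 * (n + 23).+3 ^ 2 by nia.
have hC : 9 * (n + 23).+1 ^ 2 <= 10 * (n + 23) ^ 2 by nia.
have := leq_mul hA (leq_mul hC hC).
move: IH; rewrite !(expnM _ 2 2) {hA hC}.
move: ((n + 23).+4 ^ 2) ((n + 23).+3 ^ 2) ((n + 23).+1 ^ 2) ((n + 23) ^ 2) => A B C D IH hh.
have : A * C ^ 2 <= 2 * (B * D ^ 2) by rewrite -!mulnn; nia.
by move: IH; move: (A * _) (B * _) => u v; lia.
Qed.

(** Squaring removes the floor in [host_exp k], which is at most [3k/2 - 2]. *)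
Lemma block_size_of_small_prime k p : 24 <= k -> prime p -> k < p ->
  2 * p ^ 3 <= k.-1 ^ 4 -> block k (block_size k).
Proof.
move=> k24 pr kp h; have k3 : 3 <= k by lia.
apply: (block_size_of_prime k3 pr kp).
have p0 := prime_gt0 pr.
rewrite -(@leq_exp2r _ _ 2) // (expnMn k.+2) (expnMn 4) -(expnM p) -(expnM k.-1).
have h1 : p ^ ((host_exp k).+2 * 2) <= p ^ (3 * k).
  by rewrite leq_pexp2l //; rewrite /host_exp; lia.
have h2 : 2 ^ k * p ^ (3 * k) <= k.-1 ^ (4 * k) by rewrite !expnM -expnMn leq_exp2r //; lia.
have h3 : k.-1 ^ (4 * k) = k.-1 ^ 4 * k.-1 ^ (2 * k.-1 * 2).
  by rewrite -expnD; congr (_ ^ _); lia.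
have h4 := poly_le_exp k24.
have k1 : 0 < k.-1 ^ 4 by rewrite expn_gt0 -subn1 subn_gt0 (leq_trans _ k24).
have k2 : 0 < 2 ^ k by rewrite expn_gt0.
have k12 : 0 < 2 ^ k * k.-1 ^ 4 by rewrite muln_gt0 k2 k1.
rewrite -(leq_pmul2r k12).
rewrite [2 ^ k * _]mulnC mulnACA.
apply: leq_trans (leq_mul h4 (leq_trans _ h2)) _.
  by rewrite mulnC leq_mul2l h1 orbT.
by rewrite h3; apply: eq_leq; ring.
Qed.

Lemma cube_le_exp j : 14 <= j -> 9 * j ^ 3 <= 4 * 2 ^ j.-1.
Proof.
move=> j14; have -> : j = (j - 14 + 13).+1 by lia.
elim: (j - 14) => {j j14} [|n IH]; first by rewrite add0n succnK; lia.
rewrite addSn /= [2 ^ _.+1]expnS; have h : (n + 13).+2 ^ 3 <= 2 * (n + 13).+1 ^ 3 by nia.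
by move: IH h; rewrite succnK; move: (_ ^ 3) (_ ^ 3) (2 ^ _) => a b c; lia.
Qed.

(** The criterion of [block_size_of_small_prime] allows [p] to grow like [k ^ (4/3)],
    so each prime serves a long range of [k]. *)
Lemma block_size_of_ge24 k : 24 <= k -> block k (block_size k).
Proof.
move=> k24.
have use p a b : prime p -> 2 * p ^ 3 <= a.-1 ^ 4 -> b < p -> 24 <= a <= k -> k <= b -> block k (block_size k).
  move=> pr ha bp /andP[a24 ak] kb; apply: (block_size_of_small_prime k24 pr).
    exact: leq_ltn_trans kb bp.
  by apply: leq_trans ha _; rewrite leq_exp2r //; lia.
have [k30|k30] := leqP k 30; first by apply: (@use 31 24 30); [ | lia | | lia | ].
have [k60|k60] := leqP k 60; first by apply: (@use 61 31 60); [ | lia | | lia | ].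
have [k180|k180] := leqP k 180; first by apply: (@use 181 61 180); [ | lia | | lia | ].
have [k796|k796] := leqP k 796; first by apply: (@use 797 181 796); [ | lia | | lia | ].
have [k4998|k4998] := leqP k 4998; first by apply: (@use 4999 797 4998); [ | lia | | lia | ].
clear use.
pose j := (trunc_log 2 k).+1.
have k0 : 0 < k by apply: leq_trans k24.
have jk : 2 ^ j.-1 <= k by apply: trunc_logP.
have kj : k < 2 ^ j by apply: trunc_log_ltn.
have j13 : 13 <= j.
  have : 2 ^ 12 < 2 ^ j by apply: leq_ltn_trans kj; lia.
  by rewrite ltn_exp2l.
have k12 : 12 < k by apply: leq_trans k24.
have [p pr /andP[kp pj]] := prime_in_window (leq_trans (isT : 4 <= 13) j13) k12 kj.
apply: (block_size_of_small_prime k24 pr kp).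
(* this is where 4999 is needed: [j] may be 13 *)
have cube : 9 * j ^ 3 <= 4 * k.
  case: (ltngtP 13 j) j13 => // [j14|ej] _; last by rewrite -ej; lia.
  by apply: leq_trans (cube_le_exp j14) _; rewrite leq_mul2l jk.
have hq : 17 * k ^ 2 <= 18 * k.-1 ^ 2.
  by move: k60; clear; case: k => // n; rewrite /=; nia.
have hp : p ^ 3 <= j ^ 3 * k ^ 3 by rewrite -expnMn leq_exp2r.
rewrite -(leq_pmul2l (isT : 0 < 9)).
move: (leq_mul cube (leqnn (k ^ 3))) (leq_mul hq hq); move: hp; clear.
rewrite (expnM k.-1 2 2) -[4 * k * _]mulnA -expnS (expnM k 2 2) -!mulnn -!mulnA.
move: (p ^ 3) (k ^ 3) (j ^ 3) (k ^ 2) (k.-1 ^ 2) => a b c d e; lia.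
Qed.

Lemma block_size_of_ge9 k : 9 <= k -> block k (block_size k).
Proof.
move=> k9; case: (leqP 24 k) => [|k24]; first exact: block_size_of_ge24.
have use p d e : k = d.+1 -> host_exp d.+1 = e -> 3 <= d.+1 -> prime p -> d.+1 < p ->
    d.+3 * p ^ e.+2 <= 4 * d ^ (2 * d) -> block k (block_size k).
  by move=> -> <- k3 pr ap h; apply: (block_size_of_prime k3 pr ap).
have : k \in iota 9 15 by rewrite mem_iota; lia.
rewrite !inE; do ![case/orP]; move/eqP => ek.
- by apply: (@use 11 8 11 ek erefl isT isT isT); lia.
- by apply: (@use 11 9 13 ek erefl isT isT isT); lia.
- by apply: (@use 13 10 14 ek erefl isT isT isT); lia.
- by apply: (@use 13 11 16 ek erefl isT isT isT); lia.
- by apply: (@use 17 12 17 ek erefl isT isT isT); lia.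
- by apply: (@use 17 13 19 ek erefl isT isT isT); lia.
- by apply: (@use 17 14 20 ek erefl isT isT isT); lia.
- by apply: (@use 17 15 22 ek erefl isT isT isT); lia.
- by apply: (@use 23 16 23 ek erefl isT isT isT); lia.
- by apply: (@use 23 17 25 ek erefl isT isT isT); lia.
- by apply: (@use 23 18 26 ek erefl isT isT isT); lia.
- by apply: (@use 23 19 28 ek erefl isT isT isT); lia.
- by apply: (@use 23 20 29 ek erefl isT isT isT); lia.
- by apply: (@use 23 21 31 ek erefl isT isT isT); lia.
- by apply: (@use 29 22 32 ek erefl isT isT isT); lia.
Qed.

(** For [5 <= k <= 8] every prime above [k] makes the pieces too large for the
    general combination.  The following sums of a few pieces over suitable
    primes have exactly the required size; the number subtracted last is what is
    left to cut, and it is within reach of the flexible pieces used. *)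
Lemma block_size_5 : block 5 (block_size 5).
Proof.
have b1 := blockM 5 (@block_prime_fixed 5 5 isT isT isT).
have b2 : block 5 (2 * (6 * 7 ^ 5) - 189).
  have e2 : host_exp 5 - 2 = 3 by [].
  by apply: (@block_prime_many_flexible 5 7 isT isT 2 _ isT); rewrite e2; lia.
have e : host_exp 5 = 5 by [].
have := blockD b1 b2; rewrite e; congr (block _ _).
by rewrite /block_size !big_ord_recr big_ord0 /=; lia.
Qed.

Lemma block_size_6 : block 6 (block_size 6).
Proof.
have b1 := blockM 6 (@block_prime_fixed 6 7 isT isT isT).
have b2 := @block_prime_slices 6 7 isT isT 4 isT isT.
have b3 : block 6 (7 * 7 ^ 7 - (4 * 4000 + 450)).
  have e2 : host_exp 6 - 2 = 5 by [].
  by apply: (@block_prime_flexible 6 7 isT isT _ isT); rewrite e2; lia.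
have e : host_exp 6 = 7 by [].
have := blockD (blockD b1 b2) b3; rewrite e; congr (block _ _).
by rewrite /block_size !big_ord_recr big_ord0 /=; lia.
Qed.

Lemma block_size_7 : block 7 (block_size 7).
Proof.
have b1 := blockM 137 (@block_prime_fixed 7 7 isT isT isT).
have b2 : block 7 (2 * (8 * 11 ^ 8) - (1331 * 1714 + 453)).
  have e2 : host_exp 7 - 2 = 6 by [].
  by apply: (@block_prime_many_flexible 7 11 isT isT 2 _ isT); rewrite e2; lia.
have e : host_exp 7 = 8 by [].
have := blockD b1 b2; rewrite e; congr (block _ _).
by rewrite /block_size !big_ord_recr big_ord0 /=; lia.
Qed.

Lemma block_size_8 : block 8 (block_size 8).
Proof.
have b1 := @block_prime_fixed 8 11 isT isT isT.
have b2 := @block_prime_slices 8 11 isT isT 2 isT isT.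
have b3 : block 8 (10 * (9 * 11 ^ 10) - ((664 * 1331 + 1006) * 1331 + 635)).
  have e2 : host_exp 8 - 2 = 8 by [].
  by apply: (@block_prime_many_flexible 8 11 isT isT 10 _ isT); rewrite e2; lia.
have e : host_exp 8 = 10 by [].
have := blockD (blockD b1 b2) b3; rewrite e; congr (block _ _).
by rewrite /block_size !big_ord_recr big_ord0 /=; lia.
Qed.

(** * Degrees three and four *)

Section BiCayley.

(** Let [c] list the powers of an element of order [n] modulo [p].  The pairs
    [(x, a)], standing for the affine maps [z -> c_a * z + x], form a group, which
    is the vertex set of both sides.  For [i < k] there is an edge [(x, a, i)] from
    [(x, a)] to its product with a fixed element [(y_i, d_i)].  The table [w] holds
    the products [c_a * y_i] modulo [p]. *)
Variables (p n k : nat) (c d : seq nat) (w : seq (seq nat)).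
Hypotheses (p_pr : prime p) (n_gt0 : 0 < n) (k_gt0 : 0 < k).

Let W (a i : nat) : nat := nth 0 (nth [::] w a) i.

(** The effect on the relative position [(X, j)] of a step from an edge [i] to an
    edge [i'] with the same end: [spin] is the new [j], and [drift] is added to [X].
    The residue [p - w] stands for [- w], and [X] is not reduced. *)
Definition spin (b : bool) (j i i' : nat) : nat :=
  if b then (j + nth 0 d i + (n - nth 0 d i')) %% n else j.

Definition drift (b : bool) (j i i' : nat) : nat :=
  if b then W j i + (p - W (spin b j i i') i') else 0.

(** No walk of at most [m] further steps returns to an edge [i0] at the relative
    position [(0, 0)].  Conditionals replace the Boolean connectives, which a
    call-by-value evaluation would not cut short. *)
Fixpoint avoids (i0 m : nat) (b : bool) (X j i : nat) : bool :=
  if m is m'.+1 then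
    all (fun i' => if i' == i then true else
      let j' := spin b j i i' in let X' := drift b j i i' + X in
      if (if j' == 0 then if i' == i0 then p %| X' else false else false) then false
      else avoids i0 m' (~~ b) X' j' i') (iota 0 k)
  else true.

Hypothesis d_small : all (fun i => nth 0 d i < n) (iota 0 k).
Hypothesis c_unit : all (fun a => ~~ (p %| nth 0 c a)) (iota 0 n).
Hypothesis w_small : all (fun a => all (fun i => W a i < p) (iota 0 k)) (iota 0 n).
Hypothesis w_mul : all (fun a => all (fun j => all (fun i =>
  W ((a + j) %% n) i == nth 0 c a * W j i %[mod p]) (iota 0 k)) (iota 0 n)) (iota 0 n).
Hypothesis no_closed : all (fun i =>
  avoids i (2 * k) false 0 0 i && avoids i (2 * k) true 0 0 i) (iota 0 k).

Let T : Type := ('F_p * 'I_n * 'I_k)%type.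

Definition bicayley_end (b : bool) (e : T) : 'F_p * nat :=
  let: (x, a, i) := e in
  if b then ((x + (W a i)%:R)%R, (a + nth 0 d i) %% n) else (x, val a).

Let f := bicayley_end.

Lemma d_lt (i : 'I_k) : nth 0 d i < n.
Proof. by have /allP/(_ i) := d_small; rewrite mem_iota => /(_ (ltn_ord i)). Qed.

Lemma W_lt a (i : 'I_k) : a < n -> W a i < p.
Proof.
move=> an; have /allP/(_ a) := w_small; rewrite mem_iota => /(_ an)/allP/(_ i).
by rewrite mem_iota => /(_ (ltn_ord i)).
Qed.

Lemma natr_Fp_eq0 (m : nat) : ((m%:R : 'F_p) == 0)%R = (p %| m).
Proof. by rewrite -(dvdn_pcharf (pchar_Fp p_pr)). Qed.

Lemma W_mul a j (i : 'I_k) : a < n -> j < n ->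
  ((W ((a + j) %% n) i)%:R = (nth 0 c a)%:R * (W j i)%:R :> 'F_p)%R.
Proof.
move=> an jn; have /allP/(_ a) := w_mul; rewrite mem_iota => /(_ an)/allP/(_ j).
rewrite mem_iota => /(_ jn)/allP/(_ i); rewrite mem_iota => /(_ (ltn_ord i))/eqP e.
by rewrite -natrM -(Fp_nat_mod p_pr) e Fp_nat_mod.
Qed.

Lemma spin_lt b j i i' : j < n -> spin b j i i' < n.
Proof. by case: b => //= _; rewrite ltn_pmod. Qed.

Lemma spinE (a0 a a' j : nat) (i i' : 'I_k) : a' < n -> a = (a0 + j) %% n ->
  (a' + nth 0 d i') %% n = (a + nth 0 d i) %% n -> a' = (a0 + spin true j i i') %% n.
Proof.
move=> a'n -> /eqP; rewrite modnDml => e; rewrite /spin modnDmr -(modn_small a'n).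
apply/eqP; rewrite -(eqn_modDr (nth 0 d i')) (eqP e).
have -> : a0 + (j + nth 0 d i + (n - nth 0 d i')) + nth 0 d i' = a0 + j + nth 0 d i + n.
  by have := d_lt i'; lia.
by rewrite modnDr.
Qed.

(** Left translations of the affine group act on the graph, so a walk may be
    described relative to its first edge [(x0, a0, i0)]: its current edge is
    [(x0 + c a0 * X, a0 + j, i)]. *)
Lemma walk_relative (x0 : 'F_p) (a0 : 'I_n) (X j : nat) (b : bool) (e e' : T) :
  j < n -> e.1.1 = (x0 + (nth 0 c a0)%:R * X%:R)%R -> val e.1.2 = (a0 + j) %% n ->
  e' <> e -> f b e' = f b e ->
  [/\ e'.2 != e.2, e'.1.1 = (x0 + (nth 0 c a0)%:R * (drift b j e.2 e'.2 + X)%:R)%R &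
      val e'.1.2 = (a0 + spin b j e.2 e'.2) %% n].
Proof.
case: e e' => [[x a] i] [[x' a'] i'] /= jn ex ea ne; case: b => /= /[dup] /(congr1 fst) /= e1 /(congr1 snd) /= e2.
  have ea' := spinE (ltn_ord a') ea e2.
  have e1' : (x' = x + (W a i)%:R - (W a' i')%:R)%R by rewrite -e1 addrK.
  split => //.
    apply/eqP => ii; apply: ne; move: e1 e2; rewrite ii => e1 e2.
    have eaa : a' = a.
      apply: val_inj; move/eqP: e2; rewrite eqn_modDr !modn_small // => /eqP.
      exact.
    by move: e1; rewrite eaa => /addIr ->.
  have jn' : (j + nth 0 d i + (n - nth 0 d i')) %% n < n by rewrite ltn_pmod.
  rewrite e1' ea' ea ex W_mul // W_mul ?spin_lt // !natrD natrB; last by rewrite ltnW // W_lt.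
  have -> : (p%:R = 0 :> 'F_p)%R by apply/eqP; rewrite natr_Fp_eq0.
  by rewrite /spin; ring.
split; rewrite ?add0n ?e1 ?e2 //.
by apply/eqP => ii; apply: ne; rewrite ii e1 (val_inj e2).
Qed.

Lemma bicayley_no_short_walk : no_short_walk f (2 * k).
Proof.
move=> e s r /andP[r0 rk] walk er.
pose x0 := (e 0).1.1; pose a0 := (e 0).1.2; pose i0 := (e 0).2.
have c0 : ((nth 0 c a0)%:R != 0 :> 'F_p)%R.
  by rewrite natr_Fp_eq0; have /allP/(_ a0) := c_unit; rewrite mem_iota; apply; rewrite ltn_ord.
suff main m t X j : j < n -> (e t).1.1 = (x0 + (nth 0 c a0)%:R * X%:R)%R ->
    val (e t).1.2 = (a0 + j) %% n -> avoids i0 m (odd t (+) s) X j (e t).2 ->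
    t < r <= t + m -> False.
  apply: (main (2 * k) 0 0 0) => //; rewrite ?addn0 ?mulr0 ?addr0 ?modn_small ?r0 //.
  have /allP/(_ i0) := no_closed; rewrite mem_iota => /(_ (ltn_ord i0))/andP[].
  by case: (s).
elim: m t X j => [|m IH] t X j jn ex ea; first by rewrite addn0 => _; lia.
move=> av /andP[tr rm]; have [ne fe] := walk t tr.
have [ni ex' ea'] := walk_relative jn ex ea ne fe.
move: av => /= /allP/(_ (e t.+1).2); rewrite mem_iota => /(_ (ltn_ord _)).
rewrite (negPf (_ : val (e t.+1).2 != val (e t).2)) //=; case: ifP => // ncl av.
have := leq_eqVlt t.+1 r; rewrite tr => /esym/orP[/eqP tr1|tr1]; last first.
  apply: (IH t.+1 _ _ (spin_lt _ _ _ jn) ex' ea') => //; last by rewrite tr1 addSnnS.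
  by rewrite /= addNb.
move: ncl ex' ea'; rewrite tr1 er -/x0 -/a0 -/i0 eqxx /= => ncl ex' ea'.
suff : (spin (odd t (+) s) j (e t).2 i0 == 0) && (p %| drift (odd t (+) s) j (e t).2 i0 + X).
  by case/andP=> h1 h2; rewrite h1 h2 in ncl.
apply/andP; split.
  move/eqP: ea'; rewrite -[X in X == _](modn_small (ltn_ord a0)) -[X in X == _ %[mod n]]addn0.
  by rewrite eqn_modDl mod0n modn_small ?spin_lt // eq_sym.
rewrite -natr_Fp_eq0; move/eqP: ex'; rewrite -[X in X == _]addr0 (inj_eq (addrI _)) eq_sym.
by rewrite mulf_eq0 (negPf c0).
Qed.

Lemma block_bicayley : block k (p * n).
Proof.
apply: (@block_of_graph T _ f k (p * n) setT k_gt0); last exact: bicayley_no_short_walk.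
  by rewrite cardsT !card_prod (card_Fp p_pr) !card_ord mulnC.
move=> b e _; set A := [set y in _ | _].
have inj : {in A &, injective (fun y : T => y.2)}.
  move=> [[x a] i] [[x' a'] i']; rewrite !inE => /eqP h1 /eqP h2 /= ii; subst i'.
  have : f b (x, a, i) = f b (x', a', i) by rewrite h1 h2.
  rewrite /f /=; case: b {h1 h2 A} => /= /[dup] /(congr1 fst) /= e1 /(congr1 snd) /= e2; last by rewrite e1 (val_inj e2).
  have eaa : a = a'.
    by apply: val_inj; move/eqP: e2; rewrite eqn_modDr !modn_small // => /eqP.
  by move: e1; rewrite eaa => /addIr ->.
rewrite -(card_in_imset inj) -[RHS]card_ord -[RHS]cardsT; apply: eq_card => i'.
rewrite inE; apply/imsetP; case: b @A inj => A inj; last first.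
  by exists (e.1, i'); rewrite // !inE; case: (e) => [[x a] i] /=.
case: e @A inj => [[x a] i] A inj.
pose a' := Ordinal (ltn_pmod (a + nth 0 d i + (n - nth 0 d i')) n_gt0).
exists ((x + (W a i)%:R - (W a' i')%:R)%R, a', i') => //.
rewrite !inE /= subrK; apply/eqP; congr (_, _); rewrite modnDml.
have -> : a + nth 0 d i + (n - nth 0 d i') + nth 0 d i' = a + nth 0 d i + n.
  by have := d_lt i'; lia.
by rewrite modnDr.
Qed.

End BiCayley.

(* 42 vertices on a side: the affine group of the field of 7 elements *)
Lemma block_size_3 : block 3 (block_size 3).
Proof.
have := blockM 2 (@block_bicayley 7 6 3 [:: 1; 3; 2; 6; 4; 5] [:: 0; 0; 5]
  [:: [:: 0; 3; 4]; [:: 0; 2; 5]; [:: 0; 6; 1]; [:: 0; 4; 3]; [:: 0; 5; 2]; [:: 0; 1; 6]]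
  isT isT isT isT isT isT isT _).
rewrite /block_size !big_ord_recr big_ord0; apply.
by vm_compute.
Qed.

(* 205 vertices on a side: translations and a rotation of order 5 modulo 41 *)
Lemma block_size_4 : block 4 (block_size 4).
Proof.
have := blockM 16 (@block_bicayley 41 5 4 [:: 1; 10; 18; 16; 37] [:: 0; 1; 4; 2]
  [:: [:: 0; 22; 8; 4]; [:: 0; 15; 39; 40]; [:: 0; 27; 21; 31]; [:: 0; 24; 5; 23]; [:: 0; 35; 9; 25]]
  isT isT isT isT isT isT isT _).
rewrite /block_size !big_ord_recr big_ord0; apply.
by vm_compute.
Qed.

Local Open Scope ring_scope.

(** * The bounds *)

Lemma block_sizeP k : (3 <= k)%N -> block k (block_size k).
Proof.
case: k => [|[|[|[|[|[|[|[|[|k]]]]]]]]] // _; first exact: block_size_3.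
- exact: block_size_4.
- exact: block_size_5.
- exact: block_size_6.
- exact: block_size_7.
- exact: block_size_8.
exact: block_size_of_ge9.
Qed.

(** As [(k - 1)^2 - 1 = k * (k - 2)], the fraction is [k] times a geometric sum. *)
Lemma kprimeE k : (3 <= k)%N -> kprime k = (k * block_size k)%:R.
Proof.
move=> k3; have k2 : k%:R - 2%:R != 0 :> rat by rewrite subr_eq0 eqr_nat; lia.
have e1 : (k.-1)%:R = k%:R - 1 :> rat by case: k k3 {k2} => // n _; rewrite -natr1 addrK.
rewrite /kprime; apply: (canLR (mulfK k2)).
have eB : (block_size k)%:R = 4%:R * \sum_(i < k) ((k%:R - 1) ^+ 2) ^+ i :> rat.
  by rewrite natrM natr_sum; congr (_ * _); apply: eq_bigr => i _; rewrite natrX e1 exprM.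
by rewrite exprM subrX1 natrM eB; ring.
Qed.

Lemma sigma_le m k q r : (3 <= k)%N -> (k < m)%N -> m = (k * block_size k * q + r)%N ->
  (sigma m k <= 2 * (q * block_size k) + (k %/ 2 + 1) * r)%N.
Proof.
move=> k3 km em; case: q em => [|q] em.
  have := sigma_le_degree (ltnW (ltnW k3)) km; move/leq_trans; apply.
  by rewrite em mul0n !muln0 !add0n leq_pmull // addn1.
have B0 : (0 < q.+1 * block_size k)%N.
  by rewrite muln_gt0 /= (leq_trans _ (block_size_ge (ltnW (ltnW k3)))) // muln_gt0 expn_gt0 -subn1 subn_gt0 (ltnW k3).
have := @sigma_le_block m k (q.+1 * block_size k) r (ltnW (ltnW k3)) B0 _ (blockM q.+1 (block_sizeP k3)).
move=> h; apply: leq_trans (h _) _; first by rewrite em -mulnA [(block_size k * _)%N]mulnC.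
by rewrite leq_add2l leq_pmull // addn1.
Qed.

Unset Implicit Arguments.

Theorem theorem1p2 (m k q r : nat)
    (hk3 : (3 <= k)%N) (hkm : (k <= m - 1)%N)
    (hm : m%:R = kprime k * q%:R + r%:R) (hr : r%:R < kprime k) :
  [/\ (6%:R * m%:R - 8%:R) / (3%:R * k%:R + 1) <= (sigma m k)%:R :> rat,
      (sigma m k)%:R
        <= 2%:R * kprime k * q%:R / k%:R + ((k %/ 2)%N%:R + 1) * r%:R
    & 2%:R * kprime k * q%:R / k%:R + ((k %/ 2)%N%:R + 1) * r%:R
        <= 2%:R * m%:R / k%:R + ((k %/ 2)%N%:R + 1) * (kprime k - 1)].
Proof.
have km : (k < m)%N by lia.
have k0 : 0 < k%:R :> rat by rewrite ltr0n (ltn_trans _ hk3).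
move: hm hr; rewrite kprimeE // -natrM -natrD => /eqP; rewrite eqr_nat => /eqP em.
rewrite ltr_nat => hr.
have eq2 : 2%:R * (k * block_size k)%:R * q%:R / k%:R = (2 * (q * block_size k))%:R :> rat.
  by rewrite !natrM; field; rewrite gt_eqF.
split.
- have [S sepS cS] := @orbit_dim_attained _ _ ('P^*)%act [set: 'S_m]%G (ksubsets m k).
  have /separating_ksubsetsP[bS sS] := sepS.
  have := lower_bound bS sS hk3 km; rewrite cS -/(sigma m k) => h.
  rewrite ler_pdivrMr; last by rewrite -natrM natr1 ltr0n.
  rewrite lerBlDr -!natrM natr1 -natrM -natrD ler_nat.
  by rewrite [(sigma m k * _)%N]mulnC -[(3 * k).+1]addn1.
- by rewrite eq2 natr1 -natrM -natrD ler_nat -[(k %/ 2).+1]addn1 sigma_le.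
rewrite lerD //.
  rewrite ler_pM2r ?invr_gt0 // -!natrM ler_nat -mulnA leq_mul2l em leq_addr orbT //.
rewrite ler_wpM2l ?addr_ge0 //; rewrite lerBrDr natr1 ler_nat //.
Qed.
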